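(* Let $w\in\mathcal W_{12}$, i.e. $w\colon\mathbb N^2\to[0,\infty)$ is nonincreasing in each variable. In each of the two settings (bi-parameter and Zygmund) described in the context, the following holds. There is a finite constant $C_w$ such that $$\int_\Omega H_w(x)\,dx=\sum_{I\in\mathcal U}W_w(I;\Omega)|I|\le C_w|\Omega|$$ for all admissible pairs $(\Omega,\mathcal U)$ of that setting if and only if $\|w\|_{\mathrm{ft}}<\infty$. In either setting, the optimal constant $C_w$ satisfies $$\|w\|_{\mathrm{ft}}\le C_w\le 2560\,\|w\|_{\mathrm{ft}}.$$ Moreover, if $\|w\|_{\mathrm{ft}}<\infty$, then for every admissible pair $(\Omega,\mathcal U)$ of either setting one can choose a $1/8$-sparse subfamily $\mathcal G_0\subset\mathcal U$ such that $$\int_\Omega H_w\le 2560\,\|w\|_{\mathrm{ft}}\,|\operatorname{sh}(\mathcal G_0)|.$$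
   Context: $\mathbb N=\{0,1,2,\dots\}$; $|\cdot|$ is Lebesgue measure. Fix dyadic grids $\mathcal D^i$ of cubes in $\mathbb R^{d_i}$, $i=1,2,3$ (side lengths $2^k$, $k\in\mathbb Z$). $\ell(Q)$ is the side length of $Q$, and $Q^{(k)}$ is its $k$th dyadic ancestor (the cube of the same grid containing $Q$ with side length $2^k\ell(Q)$). For a collection $\mathcal B$ of rectangles, $M_{\mathcal B}f(x):=\sup_{R\in\mathcal B,\,x\in R}\frac1{|R|}\int_R|f|$. Bi-parameter setting: rectangles are $I=I^1\times I^2\in\mathcal D^1\times\mathcal D^2$. For $\Omega\subset\mathbb R^{d_1+d_2}$ measurable of finite measure, $\widetilde\Omega:=\{M_{\mathcal D^1\times\mathcal D^2}1_\Omega>1/2\}$. Zygmund setting: rectangles are the dyadic Zygmund rectangles $I=I^1\times I^2\times I^3$, $I^i\in\mathcal D^i$, with $\ell(I^3)=\ell(I^1)\ell(I^2)$. For $\Omega\subset\mathbb R^{d_1+d_2+d_3}$ measurable of finite measure, $\widetilde\Omega:=\{M_{\mathcal D_{\mathrm{sZ}}}1_\Omega>1/2\}$, where $\mathcal D_{\mathrm{sZ}}$ consists of all $I^1\times I^2\times I^3$, $I^i\in\mathcal D^i$, with $\ell(I^3)\le\ell(I^1)\ell(I^2)$. In both settings, for a rectangle $I\subset\Omega$ and $i=1,2$, $I_i^{(k)}$ is obtained from $I$ by replacing only $I^i$ by $(I^i)^{(k)}$, and $e_i(I;\Omega):=\max\{k\ge0: I_i^{(k)}\subset\widetilde\Omega\}$.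 In either setting, $(\Omega,\mathcal U)$ is an admissible pair if $\Omega$ is measurable with finite measure and $\mathcal U$ is a family of rectangles of that setting, all contained in $\Omega$, which is incomparable: no member is contained in a different member. For $w\colon\mathbb N^2\to[0,\infty)$: $W_w(I;\Omega):=w(e_1(I;\Omega),e_2(I;\Omega))$, $H_w(x):=\sum_{I\in\mathcal U}W_w(I;\Omega)1_I(x)$, and $\|w\|_{\mathrm{ft}}:=\sup_{N\ge0}\sum_{a=0}^Nw(a,N-a)$. $\mathcal W_{12}$ is the set of such $w$ that are nonincreasing in each variable separately. $\operatorname{sh}(\mathcal G):=\bigcup_{I\in\mathcal G}I$. For $0<\eta\le1$, a family $\mathcal G$ is $\eta$-sparse if there are pairwise disjoint measurable sets $E_I\subset I$, $I\in\mathcal G$, with $|E_I|\ge\eta|I|$. *)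

(* Defs.v *)
From HB Require Import structures.
From mathcomp Require Import all_boot all_order all_algebra.
From mathcomp Require Import all_classical all_reals all_analysis.

Set Implicit Arguments.
Unset Strict Implicit.
Unset Printing Implicit Defensive.

Import Order.TTheory GRing.Theory Num.Theory.
Local Open Scope classical_set_scope.
Local Open Scope ring_scope.

(* R^n is modelled by [Rn n], a space of tuples with its Borel sigma-algebra,
   and R^m x R^n stands for R^(m + n).  Lebesgue measure is obtained as the
   n-fold product of the one-dimensional Lebesgue measure (a Borel measure,
   [borel_leb]); the settings below use its completion, whose measurable sets
   are the Lebesgue measurable ones. *)
Section Space.
Variable R : realType.

Definition Rn (n : nat) := (n.-tuple (measurableTypeR R))%type.
HB.instance Definition _ n := Measurable.on (Rn n).

Definition consRn (n : nat) (x : measurableTypeR R * Rn n) : Rn n.+1 :=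
  cons_tuple x.1 x.2.

Lemma measurable_consRn n : measurable_fun [set: _] (@consRn n).
Proof.
by apply: measurable_cons; [exact: measurable_fst|exact: measurable_snd].
Qed.

Fixpoint borel_leb (n : nat) : set (Rn n) -> \bar R :=
  match n with
  | 0 => dirac ([tuple] : Rn 0)
  | m.+1 => pushforward
      (product_measure1 (@lebesgue_measure R) (@borel_leb m)) (@consRn m)
  end.

Definition sigma_finite_copy d (T : measurableType d)
    (m : {measure set T -> \bar R}) (sm : sigma_finite setT m)
  : set T -> \bar R := m.

HB.instance Definition _ d (T : measurableType d)
    (m : {measure set T -> \bar R}) (sm : sigma_finite setT m) :=
  isMeasure.Build _ _ _ (sigma_finite_copy sm)
    (measure0 m) (measure_ge0 m) (@measure_semi_sigma_additive _ _ _ m).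

HB.instance Definition _ d (T : measurableType d)
    (m : {measure set T -> \bar R}) (sm : sigma_finite setT m) :=
  Measure_isSigmaFinite.Build _ _ _ (sigma_finite_copy sm) sm.

Lemma borel_lebP n :
  exists mu : {sigma_finite_measure set (Rn n) -> \bar R},
    (mu : set _ -> \bar R) = @borel_leb n.
Proof.
elim: n => [|n [mu IH]] /=.
  by exists (dirac ([tuple] : Rn 0)).
rewrite -IH.
pose P : {measure set (measurableTypeR R * Rn n)%type -> \bar R} :=
  (@lebesgue_measure R \x mu)%E.
pose Q : {measure set (Rn n.+1) -> \bar R} :=
  measure_function_pushforward__canonical__measure_function_Measure
    P (@measurable_consRn n).
have sQ : sigma_finite setT (Q : set _ -> \bar R).
  have [F FT Foo] : sigma_finite setT (P : set _ -> \bar R).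
    have /sigma_finiteP[A [AT ndA Aoo]] := sigma_finiteT (@lebesgue_measure R).
    have /sigma_finiteP[B [BT ndB Boo]] := sigma_finiteT mu.
    exists (fun k => A k `*` B k).
      rewrite -setXTT AT BT predeqE => -[x y]; split.
        move=> [/= [i _ Aix] [j _ Bjy]]; exists (maxn i j) => //; split.
          by move: x Aix; exact/subsetPset/ndA/leq_maxl.
        by move: y Bjy; exact/subsetPset/ndB/leq_maxr.
      by move=> [i _ []/= ? ?]; split; exists i.
    move=> k; have [? ?] := Aoo k; have [? ?] := Boo k.
    split; first exact: measurableX.
    rewrite /P /= product_measure1E//.
    by rewrite lte_mul_pinfty// ge0_fin_numE.
  pose tl (y : Rn n.+1) : measurableTypeR R * Rn n :=
    (thead y, [tuple of behead y] : Rn n).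
  have mtl : measurable_fun [set: _] tl.
    apply/measurable_fun_pairP; split.
      exact: (@measurable_tnth _ (measurableTypeR R) n.+1 ord0).
    exact: (@measurable_behead _ (measurableTypeR R) n).
  have tlK x : tl (consRn x) = x.
    case: x => x y; rewrite /tl /consRn /=; congr pair.
    exact/val_inj.
  exists (fun i => tl @^-1` F i).
    by rewrite -preimage_bigcup -FT preimage_setT.
  move=> i; have [mF Ffin] := Foo i; split.
    by rewrite -[X in measurable X]setTI; exact: mtl.
  rewrite /Q /= /pushforward -comp_preimage.
  rewrite (_ : (tl \o @consRn n) @^-1` F i = F i)//.
  by apply/seteqP; split => x /=; rewrite tlK.
by exists (sigma_finite_copy sQ).
Qed.

Section Instances.
Variable n : nat.

Let borel_leb0 : @borel_leb n set0 = 0%E.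
Proof. by have [mu <-] := borel_lebP n; exact: measure0. Qed.

Let borel_leb_ge0 A : (0 <= @borel_leb n A)%E.
Proof. by have [mu <-] := borel_lebP n; exact: measure_ge0. Qed.

Let borel_leb_sigma_additive : semi_sigma_additive (@borel_leb n).
Proof.
by have [mu <-] := borel_lebP n; exact: measure_semi_sigma_additive.
Qed.

HB.instance Definition _ := isMeasure.Build _ _ _ (@borel_leb n)
  borel_leb0 borel_leb_ge0 borel_leb_sigma_additive.

Let borel_leb_sigma_finite : sigma_finite setT (@borel_leb n).
Proof. by have [mu <-] := borel_lebP n; exact: sigma_finiteT. Qed.

HB.instance Definition _ := Measure_isSigmaFinite.Build _ _ _ (@borel_leb n)
  borel_leb_sigma_finite.

End Instances.
End Space.

Section Cubes.
Variables (R : realType) (d : nat).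

(* [(a, k)] is the half-open cube with lower corner [a] and side length 2^k. *)
Definition cube := (Rn R d * int)%type.

Definition side (Q : cube) : R := 2 ^ Q.2.

Definition cube_set (Q : cube) : set (Rn R d) :=
  [set x | forall i, tnth Q.1 i <= tnth x i < tnth Q.1 i + side Q].

Definition dyadic_grid (D : set cube) : Prop :=
  (forall (k : int) x, exists! Q, [/\ D Q, Q.2 = k & cube_set Q x]) /\
  (forall P Q, D P -> D Q -> cube_set P `&` cube_set Q !=set0 ->
     cube_set P `<=` cube_set Q \/ cube_set Q `<=` cube_set P).

(* The default value [Q] is irrelevant: in a dyadic grid (with d > 0) the
   ancestor exists and is unique. *)
Definition ancestor (D : set cube) (Q : cube) (k : nat) : cube :=
  xget Q [set P | [/\ D P, cube_set Q `<=` cube_set P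
                    & side P = 2 ^+ k * side Q]].

End Cubes.

(* What the two settings have in common: the space with its (complete)
   Lebesgue measure, boxes and the sets they represent, the rectangles of the
   setting, the boxes over which the maximal function defining the enlargement
   of Omega is taken, and the extensions [ext1 I k], [ext2 I k] of a box in its
   first and second component. *)
Record setting (R : realType) := Setting {
  disp : measure_display;
  ambient : measurableType disp;
  leb : {measure set ambient -> \bar R};
  box : choiceType;
  box_set : box -> set ambient;
  rectangles : set box;
  maximal_boxes : set box;
  ext1 : box -> nat -> box;
  ext2 : box -> nat -> box }.
Arguments leb {R} s.
Arguments rectangles {R} s.
Arguments maximal_boxes {R} s.

Section Settings.
Variables (R : realType) (d1 d2 d3 : nat).
Variables (D1 : set (cube R d1)) (D2 : set (cube R d2)) (D3 : set (cube R d3)).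

Definition leb2 := completed_measure_extension
  (mu := (@borel_leb R d1 \x @borel_leb R d2)%E).
HB.instance Definition _ := Measure.on leb2.

Definition leb3 := completed_measure_extension
  (mu := ((@borel_leb R d1 \x @borel_leb R d2) \x @borel_leb R d3)%E).
HB.instance Definition _ := Measure.on leb3.

Definition biparameter : setting R :=
  let rect := [set I : cube R d1 * cube R d2 | D1 I.1 /\ D2 I.2] in
  @Setting R _ _ leb2 (cube R d1 * cube R d2)%type
    (fun I => cube_set I.1 `*` cube_set I.2)
    rect rect
    (fun I k => (ancestor D1 I.1 k, I.2))
    (fun I k => (I.1, ancestor D2 I.2 k)).

Let box3 := (cube R d1 * cube R d2 * cube R d3)%type.

Definition zygmund : setting R :=
  @Setting R _ _ leb3 box3
    (fun I => cube_set I.1.1 `*` cube_set I.1.2 `*` cube_set I.2)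
    [set I | [/\ D1 I.1.1, D2 I.1.2, D3 I.2
               & side I.2 = side I.1.1 * side I.1.2]]
    [set I | [/\ D1 I.1.1, D2 I.1.2, D3 I.2
               & side I.2 <= side I.1.1 * side I.1.2]]
    (fun I k => (ancestor D1 I.1.1 k, I.1.2, I.2))
    (fun I k => (I.1.1, ancestor D2 I.1.2 k, I.2)).

End Settings.

Section Notions.
Variables (R : realType) (S : setting R).
Local Notation T := (ambient S).
Local Notation mu := (leb S).
Local Notation B := (box S).

Definition maximal_function (F : set B) (f : T -> R) (x : T) : \bar R :=
  ereal_sup [set ((fine (mu (box_set I)))^-1%:E *
                  \int[mu]_(y in box_set I) `|f y|%:E)%E
            | I in [set I | F I /\ box_set I x]].

Definition enlargement (Omega : set T) : set T :=
  [set x | ((2^-1)%:E < maximal_function (maximal_boxes S) \1_Omega x)%E].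

(* The largest element of a finite nonempty set of natural numbers. *)
Definition max_nat (A : set nat) : nat :=
  xget 0%N [set k | A k /\ forall j, A j -> (j <= k)%N].

Definition emb1 (I : B) (Omega : set T) : nat :=
  max_nat [set k | box_set (ext1 I k) `<=` enlargement Omega].

Definition emb2 (I : B) (Omega : set T) : nat :=
  max_nat [set k | box_set (ext2 I k) `<=` enlargement Omega].

Definition admissible (Omega : set T) (U : set B) : Prop :=
  [/\ measurable Omega, (mu Omega < +oo)%E,
      U `<=` rectangles S,
      forall I, U I -> box_set I `<=` Omega
    & forall I J, U I -> U J -> box_set I `<=` box_set J -> I = J].

Definition W_weight (w : nat -> nat -> R) (I : B) (Omega : set T) : R :=
  w (emb1 I Omega) (emb2 I Omega).

Definition H_fun (w : nat -> nat -> R) (Omega : set T) (U : set B) (x : T) :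
    \bar R :=
  \esum_(I in U) (W_weight w I Omega * \1_(box_set I) x)%:E.

Definition embedding_constant (w : nat -> nat -> R) (C : R) : Prop :=
  forall Omega U, admissible Omega U ->
    (\int[mu]_(x in Omega) H_fun w Omega U x <= C%:E * mu Omega)%E.

(* +oo when there is no finite constant *)
Definition optimal_constant (w : nat -> nat -> R) : \bar R :=
  ereal_inf [set C%:E | C in embedding_constant w].

Definition shadow (G : set B) : set T := \bigcup_(I in G) box_set I.

Definition sparse (eta : R) (G : set B) : Prop :=
  exists E : B -> set T,
    trivIset G E /\
    (forall I, G I ->
       [/\ measurable (E I), E I `<=` box_set I
         & (eta%:E * mu (box_set I) <= mu (E I))%E]).

End Notions.

Definition W12 (R : realType) (w : nat -> nat -> R) : Prop :=
  [/\ forall a b, 0 <= w a b,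
      forall a a' b, (a <= a')%N -> w a' b <= w a b
    & forall a b b', (b <= b')%N -> w a b' <= w a b].

Definition ft_norm (R : realType) (w : nat -> nat -> R) : \bar R :=
  ereal_sup (range (fun N : nat => (\sum_(a < N.+1) w a (N - a)%N)%:E)).

(* Main.v *)
Require Import Defs.
From mathcomp Require Import all_boot all_order all_algebra.
From mathcomp Require Import all_classical all_reals all_analysis.
From mathcomp Require Import measurable_realfun ring lra zify.

(* For a finite family F of members of U, call a point of I bad in direction
   i = 1, 2 if it lies in some J in F whose i-th side exceeds that of I by more
   than e_i(I) dyadic steps.  The next ancestor of I in direction i leaves the
   enlargement, so Omega fills at most half of it, and hence the points that
   are bad in direction i fill at most half of I.  In the bi-parameter setting
   the two bad sets are cylinders over different factors, so a quarter of I is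
   good in both directions.  In the Zygmund setting they may cover I; there one
   asks for goodness in one direction only, chosen according to the position of
   I relative to the rectangle through the point with the largest third side,
   and this again leaves a quarter of I.  Over a fixed point the rectangles
   that are good there form an antichain whose embedding numbers dominate
   points of two antidiagonals, with distinct coordinates, so their weights add
   up to at most 2 |w|_ft.  Hence sum_F W |I| <= 8 |w|_ft |sh F|.

   A greedy choice gives a 1/2-sparse subfamily G of F whose shadow fills half
   of every I in F, and the one-parameter dyadic covering lemma, iterated over
   slices, gives |sh F| <= 120 |sh G|.  Letting F carry half of the sum over U
   yields the constant 2 * 8 * 120 = 1920 <= 2560.

   For the lower bound, Omega is a dyadic box equal to its enlargement, and U
   consists of the rectangles of Omega whose first two sides are 2^-k and
   2^(k - N) times those of Omega, for 0 <= k <= N. *)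

Set Implicit Arguments.
Unset Strict Implicit.
Unset Printing Implicit Defensive.

Import Order.TTheory GRing.Theory Num.Theory.
Local Open Scope classical_set_scope.
Local Open Scope ring_scope.

(** * Dyadic covering lemmas *)

Section Coverings.
Variable R : realType.
Local Open Scope ereal_scope.

(** This is the weak-type inequality for the maximal operator of the sets [c i], restricted to
    indicator functions and to the single height [theta]. In this form it can be iterated over the
    factors of a product. *)
Definition covering d (T : measurableType d) (mu : set T -> \bar R)
    (I : choiceType) (D : set I) (c : I -> set T) (theta K : R) :=
  forall (F : seq I) (A : set T), {in F, forall i, D i} -> measurable A ->
    {in F, forall i, theta%:E * mu (c i) <= mu (c i `&` A)} ->
    mu (\bigcup_(i in [set` F]) c i) <= K%:E * mu A.

Definition laminar (I : choiceType) T (D : set I) (c : I -> set T) :=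
  forall i j, D i -> D j -> c i `&` c j !=set0 ->
    c i `<=` c j \/ c j `<=` c i.

(** Insert the sets one at a time. A set contained in a selected one is dropped; otherwise it
    replaces the selected sets that it contains, and laminarity makes the remaining ones disjoint
    from it. *)
Lemma laminar_disjoint_seq (I : choiceType) T (D : set I) (c : I -> set T)
    (F : seq I) : laminar D c -> {in F, forall i, D i} ->
  exists G : seq I, [/\ {subset G <= F},
    pairwise (fun i j => `[< c i `&` c j = set0 >]) G
    & \bigcup_(i in [set` G]) c i = \bigcup_(i in [set` F]) c i].
Proof.
move=> lam; elim: F => [|i F IH] DF; first by exists [::].
have [|G [GF Gdisj GE]] := IH.
  by move=> j jF; apply: DF; rewrite inE jF orbT.
have [[j jG cij]|nin] := pselect (exists2 j, j \in G & c i `<=` c j).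
  exists G; split=> //; first by move=> k /GF kF; rewrite inE kF orbT.
  rewrite GE; apply/seteqP; split=> x [k /= kF ckx].
    by exists k => //=; rewrite inE kF orbT.
  move: kF; rewrite inE => /predU1P[ki|kF]; last by exists k.
  by rewrite -GE; exists j => //; apply: cij; rewrite -ki.
exists (i :: [seq j <- G | ~~ `[< c j `<=` c i >]]); split.
- move=> k; rewrite inE => /predU1P[->|]; first by rewrite mem_head.
  by rewrite mem_filter => /andP[_ /GF kF]; rewrite inE kF orbT.
- rewrite pairwise_cons; apply/andP; split; last exact: pairwise_filter.
  apply/allP => j; rewrite mem_filter => /andP[/asboolPn ji jG].
  apply/asboolP; apply: contrapT => /eqP/set0P ij.
  have [| |//|//] := lam i j _ _ ij.
  + by apply: DF; rewrite mem_head.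
  + by apply: DF; rewrite inE (GF _ jG) orbT.
  + by move=> cij; apply: nin; exists j.
- apply/seteqP; split=> x [k /=].
    rewrite inE => /predU1P[->|]; first by exists i => //=; rewrite mem_head.
    rewrite mem_filter => /andP[_ /GF kF] ckx.
    by exists k => //=; rewrite inE kF orbT.
  rewrite inE => /predU1P[->|kF] ckx; first by exists i => //=; rewrite mem_head.
  have : (\bigcup_(i in [set` F]) c i) x by exists k.
  rewrite -GE => -[j /= jG cjx].
  have [ji|nji] := pselect (c j `<=` c i).
    by exists i => /=; [rewrite mem_head|exact: ji].
  exists j => //=; rewrite inE mem_filter jG andbT; apply/orP; right.
  exact/asboolPn.
Qed.

Lemma measurable_bigcup_seq d (T : measurableType d) (I : choiceType) (F : seq I)
    (c : I -> set T) : {in F, forall i, measurable (c i)} ->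
  measurable (\bigcup_(i in [set` F]) c i).
Proof.
move=> mc; rewrite bigcup_seq big_seq; apply: bigsetU_measurable => i; exact: mc.
Qed.

Lemma bigcup_cons (I : choiceType) T (i : I) (F : seq I) (c : I -> set T) :
  \bigcup_(j in [set` i :: F]) c j = c i `|` \bigcup_(j in [set` F]) c j.
Proof. by rewrite !bigcup_seq big_cons. Qed.

(** On a disjoint subfamily with the same union the lower bounds for [c i] intersected with [A] add
    up, and their sum is at most the measure of [A]. *)
Lemma laminar_covering d (T : measurableType d) (mu : {measure set T -> \bar R})
    (I : choiceType) (D : set I) (c : I -> set T) (theta : R) :
  (0 < theta)%R -> (forall i, D i -> measurable (c i)) -> laminar D c ->
  covering mu D c theta theta^-1.
Proof.
move=> t0 mc lam F A DF mA FA.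
have [G [GF + <-]] := laminar_disjoint_seq lam DF.
rewrite -lee_pdivrMl ?invr_gt0// invrK.
have {FA} GA : {in G, forall i, theta%:E * mu (c i) <= mu (c i `&` A)}.
  by move=> i /GF; exact: FA.
have {}mc : {in G, forall i, measurable (c i)}.
  by move=> i /GF /DF; exact: mc.
move=> Gdisj; apply: (@le_trans _ _ (mu ((\bigcup_(i in [set` G]) c i) `&` A))).
  elim: G {GF} Gdisj GA mc => [|i G IH].
    by rewrite bigcup_seq big_nil set0I measure0 mule0.
  rewrite pairwise_cons => /andP[/allP idisj Gdisj] GA mc.
  have mcG : {in G, forall j, measurable (c j)}.
    by move=> j jG; apply: mc; rewrite inE jG orbT.
  have mG := measurable_bigcup_seq mcG.
  have mi : measurable (c i) by apply: mc; rewrite mem_head.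
  rewrite bigcup_cons setIUl [leRHS]measureU;
    [|exact: measurableI|exact: measurableI|].
    apply: le_trans (leeD (GA i (mem_head _ _)) (IH Gdisj _ mcG)).
      by rewrite -ge0_muleDr// lee_pmul2l// ?lte_fin//; exact: measureU2.
    by move=> j jG; apply: GA; rewrite inE jG orbT.
  apply/seteqP; split=> // x [[cix _] [[j /= jG cjx] _]].
  have /asboolP := idisj _ jG.
  by move/seteqP => -[/(_ x) + _]; apply.
apply: le_measure; rewrite ?inE//; first apply: measurableI => //.
exact: measurable_bigcup_seq.
Qed.

End Coverings.

(** * Coverings in product spaces *)

Section ProductCovering.
Variable R : realType.
Local Open Scope ereal_scope.

Section Slices.
Context d1 d2 (T1 : measurableType d1) (T2 : measurableType d2).
Variables (m1 : {sigma_finite_measure set T1 -> \bar R})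
          (m2 : {sigma_finite_measure set T2 -> \bar R}).

(* The canonical sigma-finite structure on [m1 \x m2] expects subprobability
   measures, so it cannot be inferred here. *)
Lemma product_sigma_finite :
  exists M : {sigma_finite_measure set (T1 * T2)%type -> \bar R},
    (M : set _ -> \bar R) = (m1 \x m2).
Proof.
have sM : sigma_finite [set: (T1 * T2)%type] (m1 \x m2).
  have /sigma_finiteP[F [TF ndF Foo]] := sigma_finiteT m1.
  have /sigma_finiteP[G [TG ndG Goo]] := sigma_finiteT m2.
  exists (fun n => F n `*` G n).
    rewrite -setXTT TF TG predeqE => -[x y]; split.
      move=> [/= [n _ Fnx] [k _ Gky]]; exists (maxn n k) => //; split.
      - by move: x Fnx; exact/subsetPset/ndF/leq_maxl.
      - by move: y Gky; exact/subsetPset/ndG/leq_maxr.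
    by move=> [n _ []/= ? ?]; split; exists n.
  move=> k; have [? ?] := Foo k; have [? ?] := Goo k.
  split; first exact: measurableX.
  by rewrite product_measure1E// lte_mul_pinfty// ge0_fin_numE.
by exists (sigma_finite_copy sM).
Qed.

Lemma product_measureE2 (A : set (T1 * T2)) : measurable A ->
  (m1 \x m2) A = \int[m2]_y m1 (ysection A y).
Proof.
move=> mA; rewrite (product_measure_unique (m' := (m1 \x^ m2)%E))//.
by move=> B C mB mC; exact: product_measure2E.
Qed.

(** Let [p] and [q] be the measures of the points of [C] whose slice is filled to proportion [tau],
    and of the others. Integrating over slices gives [theta * (p + q) <= p + tau * q], that is,
    [(theta - tau) * (p + q) <= (1 - tau) * p]. *)
Lemma slice_proportion (C : set T1) (E : set T2) (A : set (T1 * T2))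
    (theta tau m : R) :
  measurable C -> measurable E -> measurable A ->
  m1 C < +oo -> 0 < m2 E -> m2 E < +oo ->
  (0 <= tau < 1)%R -> (m * (1 - tau) <= theta - tau)%R ->
  theta%:E * (m1 \x m2) (C `*` E) <= (m1 \x m2) ((C `*` E) `&` A) ->
  m%:E * m1 C <=
  m1 (C `&` [set x | tau%:E * m2 E <= m2 (E `&` xsection A x)]).
Proof.
move=> mC mE mA Coo E0 Eoo /andP[tau0 tau1] hm hA.
set G := [set x | _].
have mCE : measurable (C `*` E) by exact: measurableX.
have secE x : C x -> xsection ((C `*` E) `&` A) x = E `&` xsection A x.
  by move=> Cx; rewrite xsectionI in_xsectionX// inE.
have mG : measurable (C `&` G).
  rewrite (_ : C `&` G = C `&` [set x | tau%:E * m2 E <=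
      (m2 \o xsection ((C `*` E) `&` A)) x]); last first.
    by apply/seteqP; split=> x [Cx Gx]; split=> //=; move: Gx;
       rewrite /G /= secE.
  apply: emeasurable_fun_c_infty => //.
  apply: (@measurable_funS _ _ _ _ setT) => //; apply: measurable_fun_xsection.
  exact: measurableI.
have mN : measurable (C `\` G).
  have -> : C `\` G = C `\` (C `&` G) by rewrite setDIr setDv set0U.
  exact: measurableD.
have CE : m1 C = m1 (C `&` G) + m1 (C `\` G).
  rewrite -measureU//; first by rewrite setDE -setIUr setUv setIT.
  by rewrite setDE setIACA setICr setI0.
have Goo : m1 (C `&` G) \is a fin_num.
  rewrite ge0_fin_numE//; apply: le_lt_trans Coo.
  by apply: le_measure; rewrite ?inE//; exact: subIsetl.
have Noo : m1 (C `\` G) \is a fin_num.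
  rewrite ge0_fin_numE//; apply: le_lt_trans Coo.
  by apply: le_measure; rewrite ?inE//; exact: subDsetl.
have Efin : m2 E \is a fin_num by rewrite ge0_fin_numE.
(* A slice over a point of [G] has measure at most that of [E]; over the rest of [C] it has less
   than [tau] times that. *)
have up : (m1 \x m2) ((C `*` E) `&` A) <=
    m2 E * m1 (C `&` G) + tau%:E * m2 E * m1 (C `\` G).
  rewrite [leLHS](_ : _ = \int[m1]_x (m2 \o xsection ((C `*` E) `&` A)) x)//.
  rewrite [leRHS](_ : _ = \int[m1]_x (m2 E * (\1_(C `&` G) x)%:E +
      tau%:E * m2 E * (\1_(C `\` G) x)%:E)); last first.
    rewrite ge0_integralD//; last 4 first.
    - by move=> x _; rewrite mule_ge0// lee_fin.
    - by apply: emeasurable_funM => //; exact/measurable_EFinP.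
    - by move=> x _; rewrite !mule_ge0// lee_fin.
    - by apply: emeasurable_funM => //; exact/measurable_EFinP.
    by rewrite !ge0_integralZl ?integral_indic ?setIT ?mule_ge0 ?lee_fin//;
      exact/measurable_EFinP.
  apply: ge0_le_integral => //.
  - by apply: measurable_fun_xsection; exact: measurableI.
  - by apply: emeasurable_funD; apply: emeasurable_funM => //;
      exact/measurable_EFinP.
  - move=> x _ /=; have [Cx|nCx] := pselect (C x); last first.
      rewrite xsectionI notin_xsectionX ?notin_setE// set0I measure0.
      by rewrite adde_ge0// !mule_ge0// lee_fin.
    rewrite secE// !indicE; have [Gx|nGx] := pselect (G x).
      rewrite (mem_set (A := C `&` G))// memNset ?mule1 ?mule0 ?adde0; last by case.
      by rewrite le_measure// ?inE//; apply: measurableI => //;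
         exact: measurable_xsection.
    rewrite (memNset (A := C `&` G)) ?mem_set// ?mule1 ?mule0 ?add0e; last by case.
    by rewrite ltW// ltNge; exact/negP.
have {hA} : theta%:E * (m1 C * m2 E) <=
    m2 E * m1 (C `&` G) + tau%:E * m2 E * m1 (C `\` G).
  by apply: le_trans up; rewrite -product_measure1E.
move: E0; rewrite CE -(fineK Goo) -(fineK Noo) -(fineK Efin).
have p0 : (0 <= fine (m1 (C `&` G)))%R by rewrite fine_ge0.
have q0 : (0 <= fine (m1 (C `\` G)))%R by rewrite fine_ge0.
set p := fine _ in p0 *; set q := fine _ in q0 *; set a := fine _.
rewrite -?EFinD -?EFinM -?EFinD -?EFinM !lee_fin lte_fin => a0 h.
have {}h : (theta * (p + q) <= p + tau * q)%R.
  by rewrite -(ler_pM2r a0) -mulrA; apply: le_trans h _; lra.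
have : (m * (p + q) * (1 - tau) <= p * (1 - tau))%R.
  apply: (@le_trans _ _ ((theta - tau) * (p + q))%R); last by lra.
  by rewrite mulrAC ler_wpM2r// addr_ge0.
by rewrite ler_pM2r// subr_gt0.
Qed.

(** The intermediate set [A'] keeps from each box the points whose slice of [A] fills [tau] of the
    second side. Slices at fixed [x] bound [A'] by [A] through the second covering. At fixed [y],
    [slice_proportion] shows that [A'] fills the proportion [m] of each first side, so the first
    covering bounds the union by [A']. *)
Lemma product_covering (I : choiceType) (D : set I)
    (c : I -> set T1) (e : I -> set T2) (theta tau m K1 K2 : R) :
  (forall i, D i -> measurable (c i) /\ m1 (c i) < +oo) ->
  (forall i, D i -> measurable (e i) /\ 0 < m2 (e i) < +oo) ->
  (0 <= tau < 1)%R -> (m * (1 - tau) <= theta - tau)%R ->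
  (0 <= K1)%R -> (0 <= K2)%R ->
  covering m1 D c m K1 -> covering m2 D e tau K2 ->
  covering (m1 \x m2) D (fun i => c i `*` e i) theta (K1 * K2).
Proof.
move=> hc he htau hm K10 K20 cov1 cov2 F A DF mA hA.
pose good i := [set x | tau%:E * m2 (e i) <= m2 (e i `&` xsection A x)].
pose A' := \bigcup_(i in [set` F]) ((c i `&` good i) `*` e i).
pose U := \bigcup_(i in [set` F]) (c i `*` e i).
have mgood i : i \in F -> measurable (c i `&` good i).
  move=> /DF Di; have [mc _] := hc i Di; have [me _] := he i Di.
  rewrite (_ : good i = [set x | tau%:E * m2 (e i) <=
      (m2 \o xsection ((setT `*` e i) `&` A)) x]); last first.
    by apply/seteqP; split=> x /=; rewrite xsectionI in_xsectionX ?inE.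
  apply: emeasurable_fun_c_infty => //.
  apply: (@measurable_funS _ _ _ _ setT) => //; apply: measurable_fun_xsection.
  by apply: measurableI => //; exact: measurableX.
have mA' : measurable A'.
  apply: measurable_bigcup_seq => i iF; apply: measurableX; first exact: mgood.
  by have [] := he i (DF i iF).
have mU : measurable U.
  apply: measurable_bigcup_seq => i iF; apply: measurableX.
    by have [] := hc i (DF i iF).
  by have [] := he i (DF i iF).
have le1 : (m1 \x m2) A' <= K2%:E * (m1 \x m2) A.
  rewrite -ge0_integralZl ?lee_fin//; last exact: measurable_fun_xsection.
  apply: ge0_le_integral => //.
  - exact: measurable_fun_xsection.
  - apply: emeasurable_funM => //; exact: measurable_fun_xsection.
  move=> x _ /=.
  pose Fx := [seq i <- F | `[< c i x /\ good i x >]].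
  rewrite [X in m2 X](_ : _ = \bigcup_(i in [set` Fx]) e i); last first.
    apply/seteqP; split=> y; rewrite /xsection /= ?inE.
      move=> [i /= iF [[cix gix] eiy]]; exists i => //=.
      by rewrite mem_filter iF andbT; apply/asboolP.
    move=> [i /=]; rewrite mem_filter => /andP[/asboolP[cix gix] iF] eiy.
    by exists i.
  apply: cov2; first by move=> i; rewrite mem_filter => /andP[_ /DF].
  - exact: measurable_xsection.
  - by move=> i; rewrite mem_filter => /andP[/asboolP[]].
have le2 : (m1 \x m2) U <= K1%:E * (m1 \x m2) A'.
  rewrite !product_measureE2//.
  rewrite -ge0_integralZl ?lee_fin//; last exact: measurable_fun_ysection.
  apply: ge0_le_integral => //.
  - exact: measurable_fun_ysection.
  - apply: emeasurable_funM => //; exact: measurable_fun_ysection.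
  move=> y _ /=.
  pose Fy := [seq i <- F | `[< e i y >]].
  rewrite [X in m1 X](_ : _ = \bigcup_(i in [set` Fy]) c i); last first.
    apply/seteqP; split=> x; rewrite /ysection /= ?inE.
      move=> [i /= iF [cix eiy]]; exists i => //=.
      by rewrite mem_filter iF andbT; apply/asboolP.
    move=> [i /=]; rewrite mem_filter => /andP[/asboolP eiy iF] cix.
    by exists i.
  apply: cov1; first by move=> i; rewrite mem_filter => /andP[_ /DF].
  - exact: measurable_ysection.
  - move=> i; rewrite mem_filter => /andP[/asboolP eiy iF].
    have [mc coo] := hc i (DF i iF).
    have [me /andP[e0 eoo]] := he i (DF i iF).
    apply: le_trans (slice_proportion mc me mA coo e0 eoo htau hm (hA i iF)) _.
    apply: le_measure; rewrite ?inE; first exact: mgood.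
      by apply: measurableI => //; exact: measurable_ysection.
    by move=> x [cix gix]; split=> //; rewrite /ysection /= inE; exists i.
rewrite -/U EFinM -muleA; apply: le_trans le2 _.
by rewrite lee_wpmul2l// lee_fin.
Qed.

End Slices.

(** Continuity from below along the initial segments of an enumeration. It serves to bound the
    enlargement, which is a union of infinitely many boxes. *)
Lemma covering_countable d (T : measurableType d)
    (mu : {measure set T -> \bar R}) (I : choiceType) (D G : set I)
    (c : I -> set T) (theta K : R) (A : set T) :
  countable G -> G `<=` D -> (forall i, D i -> measurable (c i)) ->
  measurable A -> covering mu D c theta K ->
  (forall i, G i -> theta%:E * mu (c i) <= mu (c i `&` A)) ->
  mu (\bigcup_(i in G) c i) <= K%:E * mu A.
Proof.
move=> cG GD mc mA cov hG.
have [->|[g]] := elimT pfcard_geP cG.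
  have := cov [::] A; rewrite bigcup_seq big_nil bigcup_set0; exact.
have gG n : G (g n) by apply: funS.
pose F n := \bigcup_(i in [set` map g (iota 0 n)]) c i.
have mF n : measurable (F n).
  by apply: measurable_bigcup_seq => i /mapP[k _ ->]; exact/mc/GD.
have GE : \bigcup_(i in G) c i = \bigcup_n F n.
  apply/seteqP; split=> x.
    move=> [i]; rewrite -(image_eq g) => -[n _ <-] cx.
    exists n.+1 => //; exists (g n) => //.
    by apply: (map_f g); rewrite mem_iota add0n ltnS leqnn.
  by move=> [n _ [i /= /mapP[k _ ->] cx]]; exists (g k).
rewrite GE.
have /cvg_lim <- // : mu \o F @ \oo --> mu (\bigcup_n F n).
  apply: nondecreasing_cvg_mu => //; first exact: bigcup_measurable.
  move=> n m nm; apply/subsetPset => x [i /= /mapP[k + ->] cx].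
  rewrite mem_iota add0n => /andP[_ kn]; exists (g k) => //.
  by apply: (map_f g); rewrite mem_iota add0n; exact: leq_trans nm.
apply: lime_le.
  apply: ereal_nondecreasing_is_cvgn => n m nm; apply: le_measure; rewrite ?inE//.
  move=> x [i /= /mapP[k + ->] cx].
  rewrite mem_iota add0n => /andP[_ kn]; exists (g k) => //.
  by apply: (map_f g); rewrite mem_iota add0n; exact: leq_trans nm.
apply: nearW => n /=; apply: cov => //.
  by move=> i /mapP[k _ ->]; exact: GD.
by move=> i /mapP[k _ ->]; exact: hG.
Qed.

End ProductCovering.

(** * The pointwise bound *)

Section Combinatorics.

Lemma seq_argmax disp (O : orderType disp) (I : eqType) (f : I -> O)
    (r : seq I) i0 : i0 \in r ->
  exists2 i, i \in r & {in r, forall j, (f j <= f i)%O}.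
Proof.
elim: r i0 => // i r IH i0 _; case: r IH => [|k r] IH.
  by exists i => [|j]; rewrite inE// => /eqP ->.
have [m mr mmax] := IH k (mem_head _ _).
have [le_im|/ltW le_mi] := leP (f i) (f m).
  exists m => [|j]; first by rewrite inE mr orbT.
  by rewrite inE => /predU1P[->|/mmax].
exists i => [|j]; first by rewrite mem_head.
by rewrite inE => /predU1P[->//|/mmax/le_trans]; apply.
Qed.

Lemma sum_inj_le (R : numDomainType) (I : eqType) (r : seq I) (f : I -> nat)
    (N : nat) (g : nat -> R) :
  uniq r -> {in r &, injective f} -> {in r, forall i, (f i <= N)%N} ->
  (forall k, 0 <= g k) -> \sum_(i <- r) g (f i) <= \sum_(k < N.+1) g k.
Proof.
move=> ur finj fN g0.
rewrite -(big_map f predT g) -(big_mkord predT g) /index_iota subn0.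
have ufr : uniq (map f r) by rewrite map_inj_in_uniq.
rewrite (perm_big [seq k <- iota 0 N.+1 | k \in map f r]); last first.
  apply: uniq_perm => //; first exact/filter_uniq/iota_uniq.
  move=> k; rewrite mem_filter mem_iota add0n ltnS.
  have [/mapP[i ir ->]|//] := boolP (k \in map f r).
  by rewrite fN.
by rewrite big_filter [leRHS](bigID (mem (map f r)))/= lerDl sumr_ge0.
Qed.

(** Such an [A] is a union of atoms of the finite algebra generated by the [c i]. This yields
    measurability of sets defined by quantifying over a finite family without rewriting them as
    Boolean combinations. *)
Lemma measurable_saturated d (T : measurableType d) (I : eqType) (F : seq I)
    (c : I -> set T) (A : set T) : {in F, forall i, measurable (c i)} ->
  (forall x y, {in F, forall i, c i x <-> c i y} -> A x -> A y) ->
  measurable A.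
Proof.
elim: F A => [|i F IH] A mc satA.
  have [->//|/set0P[x Ax]] := eqVneq A set0.
  by rewrite (_ : A = setT)//; apply/seteqP; split=> // y _; exact: satA Ax.
have mF : {in F, forall j, measurable (c j)}.
  by move=> j jF; apply: mc; rewrite inE jF orbT.
have mi : measurable (c i) by apply: mc; rewrite mem_head.
(* The part of [A] inside [c i], or outside it, saturated with respect to the remaining sets.
   Cutting [B b] by [c i] or its complement recovers that part. *)
pose B (b : Prop) :=
  [set x | exists y, [/\ A y, c i y <-> b & {in F, forall j, c j y <-> c j x}]].
have mB b : measurable (B b).
  apply: IH => // x y xy [z [Az zb zx]]; exists z; split=> // j jF.
  by apply: iff_trans (xy j jF); exact: zx.
rewrite (_ : A = (B True `&` c i) `|` (B False `&` ~` c i)); last first.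
  apply/seteqP; split=> x.
    by move=> Ax; have [cx|ncx] := pselect (c i x); [left|right]; split=> //;
       exists x.
  move=> [|] [[y [Ay yb yx]] cx]; apply: satA Ay => j; rewrite inE;
    move=> /predU1P[->|/yx//]; split=> //; last by move/yb.
  by move=> _; exact/yb.
by apply: measurableU; apply: measurableI => //; exact: measurableC.
Qed.

(** Here [k] has the largest third side and [l] the largest second side; [i] is matched with the
    point of second coordinate [tl - ti] on the antidiagonal of length [tl - tk]. The first bound
    comes from [ti - tk <= sk - si <= a]. *)
Lemma depth_bounds (sk si tk ti tl : int) (a b : nat) :
  sk <= si + a%:Z -> tl <= ti + b%:Z -> tk <= ti -> ti <= tl ->
  si + ti <= sk + tk ->
  (`|tl - tk|%N - `|tl - ti|%N <= a)%N /\ (`|tl - ti|%N <= b)%N.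
Proof. lia. Qed.

Lemma depth_inj (tl ti tj : int) : ti <= tl -> tj <= tl ->
  `|tl - ti|%N = `|tl - tj|%N -> ti = tj.
Proof. lia. Qed.

Lemma depth_le (tk ti tl : int) : tk <= ti -> ti <= tl ->
  (`|tl - ti|%N <= `|tl - tk|%N)%N.
Proof. lia. Qed.

Lemma depth_ltW (x y : int) (n : nat) : x + n%:Z < y -> x <= y.
Proof. lia. Qed.

End Combinatorics.

(** * Finite families of rectangles in a product of three measure spaces *)

Section Embedding.
Variable R : realType.
Context d1 d2 d3 (T1 : measurableType d1) (T2 : measurableType d2)
  (T3 : measurableType d3).
Variables (m1 : {sigma_finite_measure set T1 -> \bar R})
          (m2 : {sigma_finite_measure set T2 -> \bar R})
          (m3 : {sigma_finite_measure set T3 -> \bar R}).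
Variables (I : choiceType) (F : seq I).
Variables (c1 : I -> set T1) (c2 : I -> set T2) (c3 : I -> set T3).
Variables (s t : I -> int) (a b : I -> nat).

(** The numbers [s i] and [t i] stand for binary logarithms of the first two side lengths, so [u i]
    is that of the third side by the Zygmund relation. *)
Let u i := s i + t i.
Let box i := c1 i `*` c2 i `*` c3 i.
Let P := ((m1 \x m2) \x m3)%E.

Hypothesis c1P : {in F, forall i, measurable (c1 i) /\ (m1 (c1 i) < +oo)%E}.
Hypothesis c2P : {in F, forall i, measurable (c2 i) /\ (m2 (c2 i) < +oo)%E}.
Hypothesis c3P :
  {in F, forall i, measurable (c3 i) /\ (0 < m3 (c3 i) < +oo)%E}.
Hypothesis nested1 : {in F &, forall i j x,
  c1 i x -> c1 j x -> s i <= s j -> c1 i `<=` c1 j}.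
Hypothesis nested2 : {in F &, forall i j x,
  c2 i x -> c2 j x -> t i <= t j -> c2 i `<=` c2 j}.
Hypothesis nested3 : {in F &, forall i j x,
  c3 i x -> c3 j x -> u i <= u j -> c3 i `<=` c3 j}.
Hypothesis incomparable : {in F &, forall i j, box i `<=` box j -> i = j}.

(** A rectangle that makes a point of [i] bad in direction 1 has a longer first side and hence
    covers all of [c1 i]. Badness thus does not depend on the first coordinate, and the good set can
    be recorded in the other two factors; [good2] is the same for direction 2. *)
Definition good1 i : set (T2 * T3) := [set y | [/\ c2 i y.1, c3 i y.2 &
  {in F, forall j, c1 i `<=` c1 j -> c2 j y.1 -> c3 j y.2 ->
     s j <= s i + (a i)%:Z}]].

Definition good2 i : set (T1 * T3) := [set y | [/\ c1 i y.1, c3 i y.2 &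
  {in F, forall j, c2 i `<=` c2 j -> c1 j y.1 -> c3 j y.2 ->
     t j <= t i + (b i)%:Z}]].

Hypothesis good1P : {in F, forall i,
  ((2^-1)%:E * (m2 (c2 i) * m3 (c3 i)) <= (m2 \x m3) (good1 i))%E}.
Hypothesis good2P : {in F, forall i,
  ((2^-1)%:E * (m1 (c1 i) * m3 (c3 i)) <= (m1 \x m3) (good2 i))%E}.

(* Among the rectangles through [x] with the largest third side, some has at
   least the first side of [i]. *)
Definition left_of i (x : T1 * T2 * T3) := exists j, [/\ j \in F, box j x,
  {in F, forall k, box k x -> u k <= u j} & s i <= s j].

(* The part of [i] that is good in direction 2 where [i] is [left_of] the
   rectangle with largest third side, and good in direction 1 elsewhere; the
   other direction is only required of rectangles with a larger third side. *)
Definition major i : set (T1 * T2 * T3) := [set x | [/\ box i x,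
  left_of i x -> good2 i (x.1.1, x.2) /\
    {in F, forall j, box j x -> u i <= u j -> s j <= s i + (a i)%:Z}
  & ~ left_of i x -> good1 i (x.1.2, x.2) /\
    {in F, forall j, box j x -> u i <= u j -> t j <= t i + (b i)%:Z}]].

Lemma measurable_box i : i \in F -> measurable (box i).
Proof.
move=> iF; have [? _] := c1P iF; have [? _] := c2P iF; have [? _] := c3P iF.
by apply: measurableX => //; exact: measurableX.
Qed.

Lemma measurable_good1 i : i \in F -> measurable (good1 i).
Proof.
move=> iF; apply: (@measurable_saturated _ _ _ F (fun j => c2 j `*` c3 j)).
  by move=> j jF; have [? _] := c2P jF; have [? _] := c3P jF;
     exact: measurableX.
move=> x y xy [c2x c3x gx]; have [/(_ _)[]// c2y c3y _] := xy i iF.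
by split=> // j jF ij c2j c3j; have [_ /(_ _)[]//] := xy j jF; exact: gx.
Qed.

Lemma measurable_good2 i : i \in F -> measurable (good2 i).
Proof.
move=> iF; apply: (@measurable_saturated _ _ _ F (fun j => c1 j `*` c3 j)).
  by move=> j jF; have [? _] := c1P jF; have [? _] := c3P jF;
     exact: measurableX.
move=> x y xy [c1x c3x gx]; have [/(_ _)[]// c1y c3y _] := xy i iF.
by split=> // j jF ij c1j c3j; have [_ /(_ _)[]//] := xy j jF; exact: gx.
Qed.

Lemma major_good1 i x : box i x -> good1 i (x.1.2, x.2) <->
  {in F, forall j, c1 i `<=` c1 j -> box j x -> s j <= s i + (a i)%:Z}.
Proof.
move=> [[c1x c2x] c3x]; split=> [[_ _ g] j jF ij [[_ ? ?]]|g].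
  exact: g.
by split=> // j jF ij /= c2j c3j; apply: g => //; split=> //; split=> //;
  exact: ij.
Qed.

Lemma major_good2 i x : box i x -> good2 i (x.1.1, x.2) <->
  {in F, forall j, c2 i `<=` c2 j -> box j x -> t j <= t i + (b i)%:Z}.
Proof.
move=> [[c1x c2x] c3x]; split=> [[_ _ g] j jF ij [[? _ ?]]|g].
  exact: g.
by split=> // j jF ij /= c1j c3j; apply: g => //; split=> //; split=> //;
  exact: ij.
Qed.

Lemma measurable_major i : i \in F -> measurable (major i).
Proof.
move=> iF; apply: (@measurable_saturated _ _ _ F box).
  by move=> j jF; exact: measurable_box.
move=> x y xy [ix lx rx]; have iy : box i y by exact/xy.
have left_xy : left_of i x <-> left_of i y.
  by split=> -[j [jF jx jmax sj]]; exists j; split=> //;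
     do ?[exact/xy]; move=> k kF kx; apply: jmax => //; exact/xy.
split=> //.
  move=> /left_xy /lx[/(major_good2 ix) g h]; split.
    by apply/(major_good2 iy) => j jF ij jy; apply: g => //; exact/xy.
  by move=> j jF jy; apply: h => //; exact/xy.
move=> nly; have /rx[/(major_good1 ix) g h] : ~ left_of i x by move/left_xy.
split.
  by apply/(major_good1 iy) => j jF ij jy; apply: g => //; exact/xy.
by move=> j jF jy; apply: h => //; exact/xy.
Qed.

(* The rectangles with larger third side do not see the third coordinate, so
   the case distinction in [major] is constant along the fibres. *)
Lemma left_of_fibre i z y y' : i \in F -> c3 i y -> c3 i y' -> box i (z, y) ->
  left_of i (z, y) -> left_of i (z, y').
Proof.
move=> iF iy iy' zy [j [jF [jz jy] jmax sj]].
have uij : u i <= u j by exact: jmax.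
have jy' : c3 j y' by exact: (nested3 iF jF iy jy uij).
exists j; split=> // k kF [kz ky']; rewrite leNgt; apply/negP => ujk.
have ky : c3 k y.
  by apply: (nested3 iF kF iy' ky' _ iy); exact: le_trans uij (ltW ujk).
by have := jmax k kF (conj kz ky); rewrite leNgt ujk.
Qed.

(* A fibre of [major] contains one of the two fibres on the left; since each is
   at most [m3 (c3 i)], the product bounds whichever occurs, and integrating it
   separates the variables. *)
Lemma major_fibre i (x1 : T1) (x2 : T2) : i \in F ->
  (m3 (xsection (good2 i) x1) * m3 (xsection (good1 i) x2) <=
   m3 (c3 i) * m3 (xsection (major i) (x1, x2)))%E.
Proof.
move=> iF; have [mc3 /andP[c30 c3oo]] := c3P iF.
have mg1 : measurable (xsection (good1 i) x2).
  by apply: measurable_xsection; exact: measurable_good1.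
have mg2 : measurable (xsection (good2 i) x1).
  by apply: measurable_xsection; exact: measurable_good2.
have mM : measurable (xsection (major i) (x1, x2)).
  by apply: measurable_xsection; exact: measurable_major.
have [->|/set0P[y2]] := eqVneq (xsection (good2 i) x1) set0.
  by rewrite measure0 mul0e mule_ge0.
rewrite /xsection /= inE => -[/= c1x c3y2 g2].
have [->|/set0P[y1]] := eqVneq [set y | (x2, y) \in good1 i] set0.
  by rewrite measure0 mule0 mule_ge0.
rewrite /= inE => -[/= c2x c3y1 g1].
(* A rectangle with a larger third side that meets the fibre contains all of [c3 i], so it also
   passes through height [y1], where goodness is known. Goodness at one height therefore controls
   such rectangles along the whole fibre. *)
have s_bound y : c3 i y ->
    {in F, forall j, box j (x1, x2, y) -> u i <= u j -> s j <= s i + (a i)%:Z}.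
  move=> iy j jF [[/= j1 j2] j3] uij; rewrite leNgt; apply/negP => sij.
  have : s j <= s i + (a i)%:Z; last by rewrite leNgt sij.
  apply: (g1 j jF) => //; last exact: (nested3 iF jF iy j3 uij).
  by apply: (nested1 iF jF c1x j1); exact: depth_ltW sij.
have t_bound y : c3 i y ->
    {in F, forall j, box j (x1, x2, y) -> u i <= u j -> t j <= t i + (b i)%:Z}.
  move=> iy j jF [[/= j1 j2] j3] uij; rewrite leNgt; apply/negP => tij.
  have : t j <= t i + (b i)%:Z; last by rewrite leNgt tij.
  apply: (g2 j jF) => //; last exact: (nested3 iF jF iy j3 uij).
  by apply: (nested2 iF jF c2x j2); exact: depth_ltW tij.
have [l1|nl1] := pselect (left_of i (x1, x2, y1)).
  rewrite muleC; apply: lee_pmul => //; apply: le_measure; rewrite ?inE//.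
    by move=> y /=; rewrite inE => -[].
  move=> y /=; rewrite !inE => /[dup] gy [/= _ iy _]; split => //.
  - by move=> _; split=> //; exact: s_bound.
  - move=> nl; exfalso; apply: nl.
    by apply: left_of_fibre l1.
apply: lee_pmul => //; apply: le_measure; rewrite ?inE//.
  by move=> y /=; rewrite inE => -[].
move=> y /=; rewrite !inE => /[dup] gy [/= _ iy _]; split => //.
- move=> ly; exfalso; apply: nl1.
  by apply: left_of_fibre ly.
- by move=> _; split=> //; exact: t_bound.
Qed.

(** Integrating [major_fibre] over the first two factors, the left side becomes the product of the
    measures of the two good sets. Two halves give a quarter of [P (box i)] times [m3 (c3 i)], and
    the latter factor cancels. *)
Lemma major_measure i : i \in F -> ((4^-1)%:E * P (box i) <= P (major i))%E.
Proof.
move=> iF; have [mc1 c1oo] := c1P iF; have [mc2 c2oo] := c2P iF.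
have [mc3 /andP[c30 c3oo]] := c3P iF.
have mg1 := measurable_good1 iF; have mg2 := measurable_good2 iF.
have mM := measurable_major iF.
pose f z := (m3 (xsection (good2 i) z.1) * m3 (xsection (good1 i) z.2))%E.
have mf1 : measurable_fun [set: T1] (m3 \o xsection (good2 i)).
  exact: measurable_fun_xsection.
have mf2 : measurable_fun [set: T2] (m3 \o xsection (good1 i)).
  exact: measurable_fun_xsection.
have mf : measurable_fun [set: T1 * T2] f.
  by apply: emeasurable_funM; [exact: (measurableT_comp mf1)|
                               exact: (measurableT_comp mf2)].
have intf : (\int[m1 \x m2]_z f z =
    (m1 \x m3) (good2 i) * (m2 \x m3) (good1 i))%E.
  rewrite fubini_tonelli1//; last by move=> z; rewrite mule_ge0.
  rewrite [in RHS]muleC -ge0_integralZl//.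
  by apply: eq_integral => x _; rewrite /fubini_F /f/= ge0_integralZl// muleC.
have fM : (\int[m1 \x m2]_z f z <= m3 (c3 i) * P (major i))%E.
  rewrite -ge0_integralZl//; last exact: measurable_fun_xsection.
  apply: ge0_le_integral => //.
  - by move=> z _; rewrite mule_ge0.
  - by apply: emeasurable_funM => //; exact: measurable_fun_xsection.
  - by move=> [x1 x2] _; exact: major_fibre.
have Pbox : P (box i) = (m1 (c1 i) * m2 (c2 i) * m3 (c3 i))%E.
  rewrite /P /box product_measure1E//=; last exact: measurableX.
  by rewrite product_measure1E.
have f3 : m3 (c3 i) \is a fin_num by rewrite ge0_fin_numE.
rewrite -(@lee_pmul2l _ (m3 (c3 i)))//.
apply: le_trans fM; rewrite intf Pbox.
apply: le_trans (lee_pmul _ _ (good2P iF) (good1P iF));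
  rewrite ?mule_ge0 ?lee_fin//.
have [f1 f2] : m1 (c1 i) \is a fin_num /\ m2 (c2 i) \is a fin_num.
  by rewrite !ge0_fin_numE.
rewrite -(fineK f1) -(fineK f2) -(fineK f3) -!EFinM lee_fin.
by rewrite le_eqVlt; apply/predU1P; left; field.
Qed.

(** Since the third level is the sum of the first two, order in the first two sides forces order in
    the third, so two such rectangles through a common point are nested. *)
Lemma comparable_eq i j x : i \in F -> j \in F -> box i x -> box j x ->
  s i <= s j -> t i <= t j -> i = j.
Proof.
move=> iF jF [[i1 i2] i3] [[j1 j2] j3] sij tij; apply: incomparable => // y.
move=> [[y1 y2] y3]; split; first split.
- exact: (nested1 iF jF i1 j1 sij).
- exact: (nested2 iF jF i2 j2 tij).
- by apply: (nested3 iF jF i3 j3 _ y3); exact: lerD.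
Qed.

Variables (w : nat -> nat -> R) (Gamma : R).
Hypothesis uniqF : uniq F.
Hypothesis w_ge0 : forall k l, 0 <= w k l.
Hypothesis w_nincr : forall k l k' l',
  (k <= k')%N -> (l <= l')%N -> w k' l' <= w k l.
Hypothesis w_ft : forall N, \sum_(k < N.+1) w k (N - k)%N <= Gamma.

Lemma sum_major_le x :
  \sum_(i <- F | `[< major i x >]) w (a i) (b i) <= 2 * Gamma.
Proof.
have Gamma0 : 0 <= Gamma.
  by apply: le_trans (w_ft 0); rewrite big_ord_recl big_ord0 addr0.
have [/hasP[i0 i0F /asboolP i0x]|/hasPn noF] :=
  boolP (has (fun i => `[< box i x >]) F); last first.
  rewrite big_seq_cond big1 ?mulr_ge0//.
  by move=> i /andP[/noF /asboolPn nix /asboolP[]].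
pose Fx := [seq i <- F | `[< box i x >]].
have FxP i : reflect (i \in F /\ box i x) (i \in Fx).
  rewrite mem_filter andbC; apply: (iffP andP) => -[? /asboolP ?];
    by split=> //; exact/asboolP.
have i0Fx : i0 \in Fx by exact/FxP.
have [j0 j0Fx j0max] := seq_argmax u i0Fx.
pose Fu := [seq i <- Fx | u i == u j0].
(* Among the rectangles through [x] of largest third side, [k] has the longest first side;
   [left_of i x] then reads [s i <= s k]. *)
have [k] : exists2 k, k \in Fu & {in Fu, forall j, s j <= s k}.
  by apply: (seq_argmax s (i0 := j0)); rewrite mem_filter eqxx.
rewrite mem_filter => /andP[/eqP uk kFx] kmax'.
have /FxP[kF kx] := kFx.
have umax : {in F, forall j, box j x -> u j <= u k}.
  by move=> j jF jx; rewrite uk; apply: j0max; exact/FxP.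
have left_ofE i : left_of i x <-> s i <= s k.
  split=> [[j [jF jx jmax sij]]|sik]; last by exists k.
  apply: le_trans sij _; apply: kmax'; rewrite mem_filter.
  apply/andP; split; last exact/FxP.
  by apply/eqP/le_anti; rewrite -uk umax//= jmax.
(* [k] has the largest third side.  With [l], [r] of largest second and first
   side, left rectangles are dominated by the antidiagonal of the corner
   [(s k, t l)] and the others by that of [(s r, t k)]. *)
have [l lFx lmax] := seq_argmax t kFx.
have [r rFx rmax] := seq_argmax s kFx.
have /FxP[lF lx] := lFx; have /FxP[rF rx] := rFx.
rewrite (bigID (fun i => s i <= s k))/= mulr_natl mulr2n.
apply: lerD.
  rewrite -big_filter; set G := seq.filter _ _.
  have GP i : i \in G -> [/\ i \in F, box i x, s i <= s k,
      s k <= s i + (a i)%:Z & t l <= t i + (b i)%:Z].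
    rewrite mem_filter => /andP[/andP[/asboolP[ix lfti _] sik] iF].
    have [/(major_good2 ix) g h] := (lfti ((left_ofE i).2 sik)).
    split=> //; first by apply: h => //; exact: umax.
    rewrite leNgt; apply/negP => tl; have : t l <= t i + (b i)%:Z.
      apply: g => //; case: ix lx => -[_ i2 _] [[_ l2] _].
      by apply: (nested2 iF lF i2 l2); exact: depth_ltW tl.
    by rewrite leNgt tl.
  (* A left rectangle with a shorter second side than [k] would be contained in [k]. *)
  have tmin i : i \in G -> t k <= t i.
    move=> /GP[iF ix sik _ _]; rewrite leNgt; apply/negP => tik.
    by move: (tik); rewrite (comparable_eq iF kF ix kx sik (ltW tik)) ltxx.
  have tmax i : i \in G -> t i <= t l.
    by move=> /GP[iF ix _ _ _]; apply: lmax; exact/FxP.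
  pose f i := `|t l - t i|%N; pose N := `|t l - t k|%N.
  apply: (@le_trans _ _ (\sum_(i <- G) w (N - f i)%N (f i))).
    rewrite [leLHS]big_seq [leRHS]big_seq; apply: ler_sum => i iG.
    have [iF ix sik ai bi] := GP i iG.
    have [] := depth_bounds ai bi (tmin i iG) (tmax i iG) (umax i iF ix).
    exact: w_nincr.
  (* The antidiagonal sum is reversed so that it is indexed by the second argument of [w], which is
     the one given by [f]. *)
  apply: le_trans (w_ft N); under [leRHS]eq_bigr => m _.
    rewrite -[X in w X _](@subKn m N); last by rewrite -ltnS.
    over.
  rewrite (reindex_inj rev_ord_inj)/=.
  under [leRHS]eq_bigr => m _ do rewrite subSS (@subKn m N) -1?ltnS//.
  apply: (@sum_inj_le _ _ G f N (fun m => w (N - m)%N m)) => //.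
  - exact: filter_uniq.
  (* Equal positions mean equal second sides; whichever first side is longer, one of the two
     rectangles then contains the other. *)
  - move=> i j iG jG fij; have [iF ix _ _ _] := GP i iG.
    have [jF jx _ _ _] := GP j jG.
    have tij : t i = t j.
      exact: (depth_inj (tmax i iG) (tmax j jG)).
    have [sij|/ltW sij] := leP (s i) (s j).
      by apply: (comparable_eq iF jF ix jx sij); rewrite tij.
    by apply/esym; apply: (comparable_eq jF iF jx ix sij); rewrite tij.
  - by move=> i iG; exact: (depth_le (tmin i iG) (tmax i iG)).
(* The mirror case: the first side runs between [s k] and [s r]. Its lower bound is the case
   assumption [s k < s i], so incomparability enters only through injectivity. *)
rewrite -big_filter; set G := seq.filter _ _.
have GP i : i \in G -> [/\ i \in F, box i x, s k < s i,
    s r <= s i + (a i)%:Z & t k <= t i + (b i)%:Z].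
  rewrite mem_filter -ltNge => /andP[/andP[/asboolP[ix _ rgti] sik] iF].
  have /rgti[/(major_good1 ix) g h] : ~ left_of i x.
    by move=> /left_ofE; rewrite leNgt sik.
  split=> //; last by apply: h => //; exact: umax.
  rewrite leNgt; apply/negP => sr; have : s r <= s i + (a i)%:Z.
    apply: g => //; case: ix rx => -[i1 _ _] [[r1 _] _].
    by apply: (nested1 iF rF i1 r1); exact: depth_ltW sr.
  by rewrite leNgt sr.
have smax i : i \in G -> s i <= s r.
  by move=> /GP[iF ix _ _ _]; apply: rmax; exact/FxP.
pose f i := `|s r - s i|%N; pose N := `|s r - s k|%N.
apply: (@le_trans _ _ (\sum_(i <- G) w (f i) (N - f i)%N)).
  rewrite [leLHS]big_seq [leRHS]big_seq; apply: ler_sum => i iG.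
  have [iF ix sik ai bi] := GP i iG.
  have := umax i iF ix; rewrite /u addrC (addrC (s k)) => uik.
  have [h1 h2] := depth_bounds bi ai (ltW sik) (smax i iG) uik.
  exact: w_nincr.
apply: le_trans _ (w_ft N).
apply: (@sum_inj_le _ _ G f N (fun m => w m (N - m)%N)) => //.
- exact: filter_uniq.
- move=> i j iG jG fij; have [iF ix _ _ _] := GP i iG.
  have [jF jx _ _ _] := GP j jG.
  have sij : s i = s j.
    exact: (depth_inj (smax i iG) (smax j jG)).
  have [tij|/ltW tij] := leP (t i) (t j).
    by apply: (comparable_eq iF jF ix jx _ tij); rewrite sij.
  by apply/esym; apply: (comparable_eq jF iF jx ix _ tij); rewrite sij.
- move=> i iG; have [_ _ sik _ _] := GP i iG.
  exact: (depth_le (ltW sik) (smax i iG)).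
Qed.

(** Replacing each rectangle by its major part costs a factor 4. The weighted sum of the indicators
    of these parts is at most [2 * Gamma] and vanishes off the shadow. *)
Lemma embedding_bound :
  (\sum_(i <- F) (w (a i) (b i))%:E * P (box i) <=
   (8 * Gamma)%:E * P (\bigcup_(i in [set` F]) box i))%E.
Proof.
have Gamma0 : 0 <= Gamma.
  by apply: le_trans (w_ft 0); rewrite big_ord_recl big_ord0 addr0.
have mU : measurable (\bigcup_(i in [set` F]) box i).
  by apply: measurable_bigcup_seq => i; exact: measurable_box.
apply: (@le_trans _ _
    (4%:E * \sum_(i <- F) (w (a i) (b i))%:E * P (major i))%E).
  rewrite ge0_sume_distrr; last by move=> i _; rewrite mule_ge0 ?lee_fin.
  rewrite [leLHS]big_seq [leRHS]big_seq; apply: lee_sum => i iF.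
  rewrite muleCA lee_wpmul2l ?lee_fin//.
  rewrite -(@lee_pmul2l _ (4^-1)%:E) ?lte_fin// muleA -EFinM mulVf//.
  by rewrite mul1e; exact: major_measure.
rewrite (_ : 8 * Gamma = 4 * (2 * Gamma)); last by lra.
rewrite EFinM -muleA lee_wpmul2l ?lee_fin//.
have Pint A : measurable A -> (\int[P]_x (\1_A x)%:E = P A)%E.
  by move=> mA; rewrite integral_indic// setIT.
(* The hypotheses speak of members of [F] only, so the default [set0] makes every summand
   measurable. *)
pose M i := if i \in F then major i else set0.
have mM i : measurable (M i).
  by rewrite /M; case: ifPn => // iF; exact: measurable_major.
pose h i x := ((w (a i) (b i))%:E * (\1_(M i) x)%:E)%E.
have mh i : measurable_fun setT (h i).
  by apply: emeasurable_funM => //; apply/measurable_EFinP/measurable_indic.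
have h0 i x : (0 <= h i x)%E by rewrite mule_ge0 ?lee_fin.
rewrite (eq_big_seq (fun i => (\int[P]_x h i x)%E)); last first.
  move=> i iF /=; rewrite ge0_integralZl ?lee_fin//.
    by rewrite Pint// /M iF.
  exact/measurable_EFinP/measurable_indic.
rewrite -Pint// -ge0_integralZl ?lee_fin ?mulr_ge0//; last first.
  exact/measurable_EFinP/measurable_indic.
rewrite -ge0_integral_sum//.
apply: ge0_le_integral => //.
- by move=> x _; exact: sume_ge0.
- exact: emeasurable_sum.
- by apply: emeasurable_funM => //; exact/measurable_EFinP/measurable_indic.
move=> x _.
rewrite (_ : (\sum_(i <- F) _)%E =
    (\sum_(i <- F | `[< major i x >]) w (a i) (b i))%:E); last first.
  rewrite -sumEFin [RHS]big_mkcond/=; apply: eq_big_seq => i iF.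
  rewrite /h /M iF indicE; case: asboolP => mix.
    by rewrite mem_set// mule1.
  by rewrite memNset// mule0.
rewrite -EFinM lee_fin indicE.
have [xU|nxU] := pselect ((\bigcup_(i in [set` F]) box i) x).
  by rewrite mem_set// mulr1 sum_major_le.
rewrite memNset// mulr0 big_seq_cond big1// => i /andP[iF /asboolP[ix _ _]].
by exfalso; apply: nxU; exists i.
Qed.

End Embedding.

(** * Dyadic grids *)

Section DyadicGrids.
Variable R : realType.

Lemma side_gt0 d (Q : cube R d) : 0 < side Q.
Proof. exact: exprz_gt0. Qed.

Lemma side_ge0 d (Q : cube R d) : 0 <= side Q.
Proof. exact/ltW/side_gt0. Qed.

Lemma cube_set_corner d (Q : cube R d) : cube_set Q Q.1.
Proof. by move=> i; rewrite lexx ltrDl side_gt0. Qed.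

Lemma measurable_cube_set d (Q : cube R d) : measurable (cube_set Q).
Proof.
rewrite (_ : cube_set Q = \bigcap_(i in [set: 'I_d])
    ((fun x : Rn R d => tnth x i) @^-1` `[tnth Q.1 i, tnth Q.1 i + side Q[)).
  apply: fin_bigcap_measurable => // i _; rewrite -[X in measurable X]setTI.
  exact: (@measurable_tnth _ (measurableTypeR R) d i).
by apply/seteqP; split=> x h i; [move=> _|]; have := h i; rewrite /= in_itv/=//;
  apply.
Qed.

Lemma borel_leb_cube d (Q : cube R d) :
  borel_leb (cube_set Q) = (side Q ^+ d)%:E.
Proof.
elim: d Q => [|d IH] [a k].
  by rewrite /= diracE mem_set// => -[].
pose Q' : cube R d := ([tuple of behead a], k).
have -> : borel_leb (cube_set (a, k)) =
    ((@lebesgue_measure R \x @borel_leb R d)%E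
      (`[thead a, thead a + side (a, k)[ `*` cube_set Q')).
  rewrite /= /pushforward; congr (product_measure1 _ _ _).
  apply/seteqP; split=> -[x y] /=.
    move=> h; split; first by have := h ord0; rewrite /= in_itv/=.
    move=> i; have := h (lift ord0 i).
    by rewrite !(tnth_nth 0)/= nth_behead.
  rewrite in_itv/= => -[hx hy] i; case: (unliftP ord0 i) => [j|] ->.
    have := hy j.
    by rewrite !(tnth_nth 0)/= nth_behead.
  by move: hx; rewrite /thead !(tnth_nth 0).
rewrite product_measure1E//; last exact: measurable_cube_set.
rewrite -[side (a, k)]/(side Q') [X in (_ * X)%E]IH exprS EFinM; congr (_ * _)%E.
rewrite /= lebesgue_measure_itv/= lte_fin ltrDl side_gt0.
by rewrite EFinD addeAC subee// add0e.
Qed.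

Lemma side_le d (P Q : cube R d) : (side P <= side Q) = (P.2 <= Q.2).
Proof. by rewrite /side ler_eXz2l// ltr1n. Qed.

Lemma cube_set_level d (P Q : cube R d) : (0 < d)%N ->
  cube_set P `<=` cube_set Q -> P.2 <= Q.2.
Proof.
move=> d0 PQ; have : (borel_leb (cube_set P) <= borel_leb (cube_set Q))%E.
  by apply: le_measure; rewrite ?inE//; exact: measurable_cube_set.
by rewrite !borel_leb_cube lee_fin ler_pXn2r ?nnegrE ?side_ge0// side_le.
Qed.

Section Grid.
Variables (d : nat) (D : set (cube R d)).
Hypothesis gridD : dyadic_grid D.

Lemma grid_cover k x : exists Q, [/\ D Q, Q.2 = k & cube_set Q x].
Proof. by have [Q [? _]] := gridD.1 k x; exists Q. Qed.

Lemma grid_eq P Q x : D P -> D Q -> P.2 = Q.2 ->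
  cube_set P x -> cube_set Q x -> P = Q.
Proof.
move=> DP DQ PQ Px Qx; have [A [_ uA]] := gridD.1 Q.2 x.
by rewrite -(uA P) ?(uA Q).
Qed.

Lemma grid_nested P Q x : D P -> D Q -> cube_set P x -> cube_set Q x ->
  P.2 <= Q.2 -> cube_set P `<=` cube_set Q.
Proof.
move=> DP DQ Px Qx PQ; have [| //|QP] := gridD.2 P Q DP DQ; first by exists x.
(* In dimension 0 every cube is the whole one-point space, whatever its level. This case occurs as
   the third factor in the bi-parameter setting. *)
have [d0|d0] := posnP d; first
  by move=> y _ i; have := ltn_ord i; rewrite [X in (_ < X)%N]d0.
suff -> : P = Q by [].
apply: (grid_eq DP DQ _ Px Qx); apply/le_anti.
by rewrite PQ (cube_set_level d0 QP).
Qed.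

Lemma grid_laminar : laminar D (@cube_set R d).
Proof. exact: gridD.2. Qed.

Lemma ancestorP Q k : D Q -> [/\ D (ancestor D Q k),
  cube_set Q `<=` cube_set (ancestor D Q k) & (ancestor D Q k).2 = k%:Z + Q.2].
Proof.
move=> DQ.
have sideE (P : cube R d) : side P = 2 ^+ k * side Q <-> P.2 = k%:Z + Q.2.
  rewrite /side (_ : 2 ^+ k = 2 ^ k%:Z)// -expfzDr//; split=> [|->//].
  by apply: ieexprIz => //; rewrite gt_eqF// ltr1n.
have [A [DA A2 Ax]] := grid_cover (k%:Z + Q.2) Q.1.
have [] := @xgetPex _ Q [set P | [/\ D P, cube_set Q `<=` cube_set P
                    & side P = 2 ^+ k * side Q]].
  exists A; split=> //; last exact/sideE.
  apply: (grid_nested DQ DA (cube_set_corner Q) Ax).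
  by rewrite A2 lerDr.
by move=> h1 h2 /sideE h3; split.
Qed.

(** In positive dimension a cube of strictly lower level has at most half the side, hence at most
    half the measure. This shows that a dyadic box equals its own enlargement in the lower bound. *)
Lemma grid_half P Q x : D P -> D Q -> cube_set P x -> cube_set Q x ->
  cube_set P `<=` cube_set Q \/
  (borel_leb (cube_set Q) <= (2^-1)%:E * borel_leb (cube_set P))%E.
Proof.
move=> DP DQ Px Qx; have [PQ|QP] := leP P.2 Q.2.
  by left; exact: (grid_nested DP DQ Px Qx).
have [d0|d0] := posnP d.
  by left=> y _ i; have := ltn_ord i; rewrite [X in (_ < X)%N]d0.
right; rewrite !borel_leb_cube -EFinM lee_fin.
have sQP : side Q <= 2^-1 * side P.
  rewrite -[leRHS](_ : 2 ^ (P.2 - 1) = _).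
    by rewrite ler_eXz2l ?ltr1n//; move: QP; clear; lia.
  by rewrite expfzDr// exprN1 mulrC.
move: d0; case: (d) P Q {DP DQ Px Qx QP} sQP => // n P Q sQP _.
rewrite !exprS mulrA ler_pM ?exprn_ge0 ?side_ge0//.
rewrite lerXn2r ?nnegrE ?side_ge0//; apply: le_trans sQP _.
by have := side_gt0 P; lra.
Qed.

(** A cube of the grid is determined by its level and any rational point in it. *)
Lemma countable_grid : countable D.
Proof.
pose f (p : int * d.-tuple rat) : cube R d :=
  xget ([tuple of nseq d 0], 0)
    [set Q | [/\ D Q, Q.2 = p.1 & cube_set Q [tuple of map ratr p.2]]].
apply: (@sub_countable _ _ _ (range f)); last first.
  by apply: card_le_trans (card_image_le _ _) _; exact: countableP.
apply: subset_card_le => Q DQ.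
have /choice[q hq] i : exists q : rat,
    tnth Q.1 i <= ratr q < tnth Q.1 i + side Q.
  have [|q] := @rat_in_itvoo R (tnth Q.1 i) (tnth Q.1 i + side Q).
    by rewrite ltrDl side_gt0.
  by rewrite in_itv/= => /andP[/ltW ? ?]; exists q; apply/andP.
have Qq : cube_set Q [tuple of map ratr [tuple q i | i < d]].
  by move=> i; rewrite tnth_map tnth_mktuple.
exists (Q.2, [tuple q i | i < d]) => //; rewrite /f/=.
case: xgetP => [P -> [DP P2 Pq]|/(_ Q)]; first exact: (grid_eq DP DQ P2 Pq).
by case.
Qed.

End Grid.

End DyadicGrids.

(** * Cylinders in a threefold product *)

Section ProductSplit.
Context (R : realType) d1 d2 d3 (T1 : measurableType d1)
  (T2 : measurableType d2) (T3 : measurableType d3).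
Variables (m1 : {sigma_finite_measure set T1 -> \bar R})
          (m2 : {sigma_finite_measure set T2 -> \bar R})
          (m3 : {sigma_finite_measure set T3 -> \bar R}).
Local Open Scope ereal_scope.

(** The bad points of a rectangle in direction 1, thickened by an ancestor of its first side, form
    such a set; [cyl2] serves direction 2. *)
Definition cyl1 (A : set T1) (B : set (T2 * T3)) : set (T1 * T2 * T3) :=
  [set x | A x.1.1 /\ B (x.1.2, x.2)].
Definition cyl2 (A : set T2) (B : set (T1 * T3)) : set (T1 * T2 * T3) :=
  [set x | A x.1.2 /\ B (x.1.1, x.2)].

Let measurable_fst12 : measurable_fun setT (@fst (T1 * T2) T3).
Proof. exact: measurable_fst. Qed.

Let measurable_x1 : measurable_fun setT (fun x : T1 * T2 * T3 => x.1.1).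
Proof. exact: measurableT_comp measurable_fst measurable_fst12. Qed.

Let measurable_x2 : measurable_fun setT (fun x : T1 * T2 * T3 => x.1.2).
Proof. exact: measurableT_comp measurable_snd measurable_fst12. Qed.

Lemma measurable_cyl1 A B : measurable A -> measurable B ->
  measurable (cyl1 A B).
Proof.
move=> mA mB.
have mp : measurable_fun setT (fun x : T1 * T2 * T3 => (x.1.2, x.2)).
  by apply/measurable_fun_pairP; split; last exact: measurable_snd.
have := measurableI _ _ (measurable_x1 measurableT mA) (mp measurableT B mB).
by rewrite !setTI.
Qed.

Lemma measurable_cyl2 A B : measurable A -> measurable B ->
  measurable (cyl2 A B).
Proof.
move=> mA mB.
have mp : measurable_fun setT (fun x : T1 * T2 * T3 => (x.1.1, x.2)).
  by apply/measurable_fun_pairP; split; last exact: measurable_snd.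
have := measurableI _ _ (measurable_x2 measurableT mA) (mp measurableT B mB).
by rewrite !setTI.
Qed.

Lemma product_cyl1 A B : measurable A -> measurable B ->
  ((m1 \x m2) \x m3) (cyl1 A B) = m1 A * (m2 \x m3) B.
Proof.
move=> mA mB.
have mf : measurable_fun [set: T2] (m3 \o xsection B).
  exact: measurable_fun_xsection.
rewrite [LHS](_ : _ = \int[m1 \x m2]_z
    ((\1_A z.1)%:E * (m3 \o xsection B) z.2)); last first.
  apply: eq_integral => -[x1 x2] _ /=; rewrite indicE.
  have [Ax|nAx] := pselect (A x1).
    rewrite mem_set// mul1e; congr (m3 _); apply/seteqP.
    by split=> y; rewrite /xsection /= !inE; [case|split].
  rewrite memNset// mul0e (_ : xsection _ _ = set0) ?measure0//.
  by apply/seteqP; split=> y //; rewrite /xsection /= inE => -[].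
rewrite fubini_tonelli1; last first.
- by move=> z; rewrite mule_ge0// lee_fin.
- apply: emeasurable_funM; last exact: (measurableT_comp mf).
  apply/measurable_EFinP; apply: (measurableT_comp (measurable_indic mA)).
  exact: measurable_fst.
rewrite /fubini_F/=.
under eq_integral => x _ do rewrite ge0_integralZl// ?lee_fin//.
rewrite ge0_integralZr//; last 2 first.
- exact/measurable_EFinP/measurable_indic.
- exact: integral_ge0.
by rewrite integral_indic// setIT.
Qed.

Lemma product_cyl2 A B : measurable A -> measurable B ->
  ((m1 \x m2) \x m3) (cyl2 A B) = m2 A * (m1 \x m3) B.
Proof.
move=> mA mB.
have mf : measurable_fun [set: T1] (m3 \o xsection B).
  exact: measurable_fun_xsection.
rewrite [LHS](_ : _ = \int[m1 \x m2]_z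
    ((\1_A z.2)%:E * (m3 \o xsection B) z.1)); last first.
  apply: eq_integral => -[x1 x2] _ /=; rewrite indicE.
  have [Ax|nAx] := pselect (A x2).
    rewrite mem_set// mul1e; congr (m3 _); apply/seteqP.
    by split=> y; rewrite /xsection /= !inE; [case|split].
  rewrite memNset// mul0e (_ : xsection _ _ = set0) ?measure0//.
  by apply/seteqP; split=> y //; rewrite /xsection /= inE => -[].
rewrite fubini_tonelli2; last first.
- by move=> z; rewrite mule_ge0// lee_fin.
- apply: emeasurable_funM; last exact: (measurableT_comp mf).
  apply/measurable_EFinP; apply: (measurableT_comp (measurable_indic mA)).
  exact: measurable_snd.
rewrite /fubini_G/=.
under eq_integral => x _ do rewrite ge0_integralZl// ?lee_fin//.
rewrite ge0_integralZr//; last 2 first.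
- exact/measurable_EFinP/measurable_indic.
- exact: integral_ge0.
by rewrite integral_indic// setIT.
Qed.

End ProductSplit.

(** * Maxima of sets of integers and greedy sparse selection *)

Section Setting.
Variables (R : realType) (S : setting R).
Local Notation T := (ambient S).
Local Notation mu := (leb S).
Local Open Scope ereal_scope.

Lemma max_natP (A : set nat) (n : nat) : A 0%N ->
  (forall k, A k -> (k <= n)%N) ->
  A (max_nat A) /\ forall k, A k -> (k <= max_nat A)%N.
Proof.
move=> A0 An.
suff [k [Ak kmax]] : exists k, A k /\ forall j, A j -> (j <= k)%N.
  by apply: (@xgetPex _ 0%N [set k | A k /\ forall j, A j -> (j <= k)%N]);
     exists k.
have ex : exists k, `[< A k >] by exists 0%N; exact/asboolP.
have ub k : `[< A k >] -> (k <= n)%N by move/asboolP; exact: An.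
case: (ex_maxnP ex ub) => k /asboolP Ak kmax.
by exists k; split=> // j Aj; apply: kmax; exact/asboolP.
Qed.

Lemma max_natE (A : set nat) (n : nat) : A n ->
  (forall k, A k -> (k <= n)%N) -> max_nat A = n.
Proof.
move=> An Amax; rewrite /max_nat.
case: xgetP => [k _ [Ak kmax]|/(_ n)[]//].
by apply/eqP; rewrite eqn_leq Amax// kmax.
Qed.

(** A rectangle is selected when the shadow so far fills less than half of it; the uncovered part,
    more than half, is its private set. A rejected rectangle is already half filled, and remains so
    as the shadow grows. *)
Lemma greedy_sparse (F : seq (box S)) :
  {in F, forall I, measurable (box_set I) /\ mu (box_set I) < +oo} ->
  exists G : seq (box S), [/\ {subset G <= F},
    sparse 2^-1 [set` G]
  & {in F, forall I,
      (2^-1)%:E * mu (box_set I) <= mu (box_set I `&` shadow [set` G])}].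
Proof.
elim: F => [|I F IH] hF; first by exists [::]; split=> //; exists (fun=> set0).
have [J JF|G [GF [E [triE hE]] GI]] := IH.
  by apply: hF; rewrite inE JF orbT.
have [mI Ioo] := hF I (mem_head _ _).
have mG : measurable (shadow [set` G]).
  apply: measurable_bigcup_seq => J /GF JF.
  by have [] := hF J; rewrite // inE JF orbT.
have GsubF : {subset G <= I :: F} by move=> J /GF JF; rewrite inE JF orbT.
have [le_I|/negP lt_I] := pselect
    ((2^-1)%:E * mu (box_set I) <= mu (box_set I `&` shadow [set` G])).
  exists G; split=> //; first by exists E.
  by move=> J; rewrite inE => /predU1P[->//|/GI].
have shU : shadow [set` I :: G] = box_set I `|` shadow [set` G].
  exact: bigcup_cons.
exists (I :: G); split.
- by move=> J; rewrite inE => /predU1P[->|/GsubF//]; rewrite mem_head.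
(* The earlier private sets lie in the shadow of [G], so they are disjoint from the new one. *)
- exists (fun J => if J == I then box_set I `\` shadow [set` G] else E J).
  have EG J : J \in G -> E J `<=` shadow [set` G].
    by move=> JG x EJx; exists J => //; have [_ + _] := hE J JG; apply.
  split.
    move=> J K /=; rewrite !inE.
    case: eqP => [-> _|_ /= JG]; case: eqP => [-> _|_ /= KG] //.
    - by move=> [x [[_ nGx] Ex]]; exfalso; apply: nGx; exact: EG Ex.
    - by move=> [x [Ex [_ nGx]]]; exfalso; apply: nGx; exact: EG Ex.
    - exact: triE.
  move=> J /=; rewrite inE; case: eqP => [-> _|_ /= JG]; last exact: hE.
  split; [exact: measurableD|exact: subDsetl|].
  move: lt_I; rewrite -ltNge => lt_I.
  have mIG : measurable (box_set I `&` shadow [set` G]) by exact: measurableI.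
  have mDG : measurable (box_set I `\` shadow [set` G]) by exact: measurableD.
  have muIE : mu (box_set I) = mu (box_set I `&` shadow [set` G]) +
      mu (box_set I `\` shadow [set` G]).
    rewrite -measureU//; first by rewrite setDE -setIUr setUv setIT.
    by rewrite setDE setIACA setICr setI0.
  have f1 : mu (box_set I `&` shadow [set` G]) \is a fin_num.
    rewrite ge0_fin_numE//; apply: le_lt_trans Ioo.
    by apply: le_measure; rewrite ?inE//; exact: subIsetl.
  have f2 : mu (box_set I `\` shadow [set` G]) \is a fin_num.
    rewrite ge0_fin_numE//; apply: le_lt_trans Ioo.
    by apply: le_measure; rewrite ?inE//; exact: subDsetl.
  move: lt_I; rewrite muIE -(fineK f1) -(fineK f2).
  rewrite -?EFinD -?EFinM lte_fin lee_fin; lra.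
- have half_le (x : \bar R) : 0 <= x -> (2^-1)%:E * x <= x.
    move=> x0; apply: (@le_trans _ _ (1%:E * x)); last by rewrite mul1e.
    by apply: lee_pmul; rewrite ?lee_fin//; lra.
  move=> J; rewrite inE => /predU1P[->|JF]; rewrite shU.
    by rewrite setIidl ?half_le//; exact: subsetUl.
  apply: le_trans (GI J JF) _; have [|mJ _] := hF J.
    by rewrite inE JF orbT.
  have mJG : measurable (box_set J `&` shadow [set` G]) by exact: measurableI.
  have mJU : measurable (box_set J `&` (box_set I `|` shadow [set` G])).
    by apply: measurableI => //; exact: measurableU.
  apply: le_measure; rewrite ?inE//; apply: setIS; exact: subsetUr.
Qed.

End Setting.

(** * Measurability and integral of [H_fun] *)

Section HFunction.
Variables (R : realType) (S : setting R) (w : nat -> nat -> R).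
Local Notation mu := (leb S).
Hypothesis w_ge0 : forall a b, 0 <= w a b.
Variables (Omega : set (ambient S)) (U : set (box S)).
Hypothesis cU : countable U.
Hypothesis mU : forall I, U I -> measurable (box_set I).
Local Open Scope ereal_scope.

Let W_ge0 I : (0 <= W_weight w I Omega)%R. Proof. exact: w_ge0. Qed.

(** An injection of [U] into the natural numbers turns sums over [U] into series, with zeros off its
    image, to which term-by-term integration applies. Nonemptiness supplies the value of [g] off
    that image. *)
Lemma esum_series : U !=set0 ->
  exists g : nat -> box S, exists B : set nat, (forall n, B n -> U (g n)) /\
    forall a : box S -> \bar R, (forall I, 0 <= a I) ->
    \esum_(I in U) a I = \sum_(n <oo) (if n \in B then a (g n) else 0).
Proof.
move=> [I0 UI0]; have /countable_injP[f finj] := cU.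
pose g n := xget I0 [set I | U I /\ f I = n].
have gK I : U I -> g (f I) = I.
  move=> UI; rewrite /g; case: xgetP => [J _ [UJ fJ]|/(_ I)[]//].
  by apply: finj; rewrite ?inE.
exists g, (f @` U); split; first by move=> _ [I UI <-]; rewrite gK.
move=> a a0; rewrite nneseries_esumT; last by move=> n; case: ifP.
rewrite -esum_mkcond esum_image; last by move=> I J UI UJ; exact: finj.
by apply: eq_esum => I UI; rewrite gK.
Qed.

Lemma measurable_H : measurable_fun setT (H_fun w Omega U).
Proof.
have [U0|/set0P/esum_series[g [B [BU gE]]]] := eqVneq U set0.
  have -> : H_fun w Omega U = cst (0 : \bar R).
    by apply/funext => x; rewrite /H_fun U0 esum_set0.
  exact: measurable_cst.
rewrite (_ : H_fun w Omega U = fun x => \sum_(n <oo) (if n \in B then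
    (W_weight w (g n) Omega * \1_(box_set (g n)) x)%:E else 0)).
  apply: ge0_emeasurable_sum => [n x _ _|n _]; have [nB|//] := boolP (n \in B).
    by rewrite lee_fin mulr_ge0.
  apply/measurable_EFinP; apply: measurable_funM => //.
  by apply: measurable_indic; apply: mU; apply: BU; rewrite -inE.
by apply/funext => x; rewrite /H_fun gE// => I; rewrite lee_fin mulr_ge0.
Qed.

Lemma integral_H : measurable Omega -> (forall I, U I -> box_set I `<=` Omega) ->
  \int[mu]_(x in Omega) H_fun w Omega U x =
  \esum_(I in U) ((W_weight w I Omega)%:E * mu (box_set I)).
Proof.
move=> mO UO.
have [U0|/set0P/esum_series[g [B [BU gE]]]] := eqVneq U set0.
  rewrite U0 esum_set0 integral0_eq// => x _.
  by rewrite /H_fun esum_set0.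
rewrite gE; last by move=> I; rewrite mule_ge0// lee_fin.
pose h n x : \bar R := if n \in B then
    (W_weight w (g n) Omega * \1_(box_set (g n)) x)%:E else 0.
have h0 n x : 0 <= h n x.
  by rewrite /h; case: ifPn => // _; rewrite lee_fin mulr_ge0.
rewrite (eq_integral (fun x => \sum_(n <oo) h n x)); last first.
  by move=> x _; rewrite /H_fun gE// => I; rewrite lee_fin mulr_ge0.
have mind n : n \in B ->
    measurable_fun Omega (fun x => (\1_(box_set (g n)) x)%:E : \bar R).
  move=> nB; apply/measurable_EFinP; apply: measurable_indic; apply: mU.
  by apply: BU; rewrite -inE.
rewrite integral_nneseries//; last first.
  move=> n; rewrite /h; have [nB|//] := boolP (n \in B).
  under eq_fun do rewrite EFinM.
  by apply: emeasurable_funM => //; exact: mind.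
apply: eq_eseriesr => n _; rewrite /h.
have [nB|nB] := boolP (n \in B); last exact: integral0.
under eq_integral => x _ do rewrite EFinM.
have Un : U (g n) by apply: BU; rewrite -inE.
rewrite ge0_integralZl ?lee_fin//; last exact: mind.
by rewrite integral_indic//; [rewrite setIidl//; exact: UO|exact: mU].
Qed.

End HFunction.

(** * Dyadic rectangle settings *)

Section Model.
Variables (R : realType) (d1 d2 d3 : nat).
Variables (D1 : set (cube R d1)) (D2 : set (cube R d2)) (D3 : set (cube R d3)).
Variable S : setting R.
Variables (pt : ambient S -> Rn R d1 * Rn R d2 * Rn R d3)
  (c1 : box S -> cube R d1) (c2 : box S -> cube R d2) (c3 : box S -> cube R d3).

Local Notation mu := (leb S).
Local Notation m1 := (@borel_leb R d1).
Local Notation m2 := (@borel_leb R d2).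
Local Notation m3 := (@borel_leb R d3).
Local Notation P := ((m1 \x m2) \x m3)%E.

Definition cell (I : box S) : set (Rn R d1 * Rn R d2 * Rn R d3) :=
  cube_set (c1 I) `*` cube_set (c2 I) `*` cube_set (c3 I).

(* The coordinates [pt], [c1], [c2], [c3] present [S] as a setting of dyadic
   Zygmund rectangles.  The bi-parameter setting is the case [d3 = 0]: a cube
   of [R^0] is a point carrying an arbitrary side length. *)
Record dyadic_model : Prop := DyadicModel {
  pt_onto : forall z, exists x, pt x = z;
  box_setE : forall I, box_set I = pt @^-1` cell I;
  measurable_pt : forall A, measurable A -> measurable (pt @^-1` A);
  leb_pt : forall A, measurable A -> mu (pt @^-1` A) = P A;
  outer_pt : forall Omega, (mu Omega < +oo)%E ->
    exists A, [/\ measurable A, Omega `<=` pt @^-1` A & (P A < +oo)%E];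
  coord_inj : forall I J, c1 I = c1 J -> c2 I = c2 J -> c3 I = c3 J -> I = J;
  rectangle_level : forall I, rectangles S I -> (c3 I).2 = (c1 I).2 + (c2 I).2;
  rectangle_maximal : forall I, rectangles S I -> maximal_boxes S I;
  maximal_grid : forall I, maximal_boxes S I ->
    [/\ D1 (c1 I), D2 (c2 I) & D3 (c3 I)];
  rectangle_with : forall Q1 Q2 Q3, D1 Q1 -> D2 Q2 -> D3 Q3 ->
    Q3.2 = Q1.2 + Q2.2 ->
    exists I, [/\ rectangles S I, c1 I = Q1, c2 I = Q2 & c3 I = Q3];
  ext1_maximal : forall I k, rectangles S I -> maximal_boxes S (ext1 I k);
  ext2_maximal : forall I k, rectangles S I -> maximal_boxes S (ext2 I k);
  cell_ext1 : forall I k, cell (ext1 I k) =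
    cube_set (ancestor D1 (c1 I) k) `*` cube_set (c2 I) `*` cube_set (c3 I);
  cell_ext2 : forall I k, cell (ext2 I k) =
    cube_set (c1 I) `*` cube_set (ancestor D2 (c2 I) k) `*` cube_set (c3 I) }.

Hypotheses (gridD1 : dyadic_grid D1) (gridD2 : dyadic_grid D2)
  (gridD3 : dyadic_grid D3).
Hypotheses (d1_gt0 : (0 < d1)%N) (d2_gt0 : (0 < d2)%N).
Hypothesis model : dyadic_model.

Lemma measurable_cell I : measurable (cell I).
Proof.
by apply: measurableX; [apply: measurableX|]; exact: measurable_cube_set.
Qed.

Lemma measurable_box_set (I : box S) : measurable (box_set I).
Proof. by rewrite box_setE//; apply: measurable_pt => //; exact: measurable_cell. Qed.

Lemma borel_leb_cube_fin d (Q : cube R d) :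
  (0 < borel_leb (cube_set Q) < +oo)%E.
Proof. by rewrite borel_leb_cube ltry lte_fin exprn_gt0// side_gt0. Qed.

Lemma P_prod A1 A2 A3 : measurable A1 -> measurable A2 -> measurable A3 ->
  P (A1 `*` A2 `*` A3) = (m1 A1 * m2 A2 * m3 A3)%E.
Proof.
move=> mA1 mA2 mA3; rewrite product_measure1E//=; last exact: measurableX.
by rewrite product_measure1E.
Qed.

Lemma P_cubes Q1 Q2 Q3 : P (cube_set Q1 `*` cube_set Q2 `*` cube_set Q3) =
  (side Q1 ^+ d1 * side Q2 ^+ d2 * side Q3 ^+ d3)%:E.
Proof.
rewrite P_prod; [|exact: measurable_cube_set..].
by rewrite !borel_leb_cube.
Qed.

Lemma P_cell_gt0 I : (0 < P (cell I))%E.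
Proof. by rewrite P_cubes lte_fin !mulr_gt0// exprn_gt0// side_gt0. Qed.

Lemma P_cell_lty I : (P (cell I) < +oo)%E.
Proof. by rewrite P_cubes ltry. Qed.

Lemma leb_box (I : box S) : mu (box_set I) = P (cell I).
Proof. by rewrite box_setE// leb_pt//; exact: measurable_cell. Qed.

Lemma pt_sub (A B : set (Rn R d1 * Rn R d2 * Rn R d3)) :
  pt @^-1` A `<=` pt @^-1` B -> A `<=` B.
Proof.
by move=> AB z Az; have [x xz] := pt_onto model z; rewrite -xz; apply: AB;
   rewrite /= xz.
Qed.

Lemma box_sub (I J : box S) : box_set I `<=` box_set J ->
  [/\ cube_set (c1 I) `<=` cube_set (c1 J),
      cube_set (c2 I) `<=` cube_set (c2 J)
    & cube_set (c3 I) `<=` cube_set (c3 J)].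
Proof.
rewrite !box_setE// => /pt_sub IJ.
have h1 := cube_set_corner (c1 I); have h2 := cube_set_corner (c2 I).
have h3 := cube_set_corner (c3 I).
split=> x Ix.
- by have [] := IJ (x, (c2 I).1, (c3 I).1) (conj (conj Ix h2) h3); case.
- by have [] := IJ ((c1 I).1, x, (c3 I).1) (conj (conj h1 Ix) h3); case.
- by have [] := IJ ((c1 I).1, (c2 I).1, x) (conj (conj h1 h2) Ix).
Qed.

Lemma countable_boxes : countable (maximal_boxes S).
Proof.
have /countable_injP[f1 f1inj] := countable_grid gridD1.
have /countable_injP[f2 f2inj] := countable_grid gridD2.
have /countable_injP[f3 f3inj] := countable_grid gridD3.
apply/countable_injP.
exists (fun I => pickle (f1 (c1 I), f2 (c2 I), f3 (c3 I))) => I J.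
rewrite !inE => /(maximal_grid model)[I1 I2 I3].
move=> /(maximal_grid model)[J1 J2 J3] /(pcan_inj (@pickleK _)) [e1 e2 e3].
by apply: (coord_inj model); [apply: f1inj|apply: f2inj|apply: f3inj];
  rewrite ?inE.
Qed.

(* The slice thresholds 1/5, 1/6, 1/4 come from
   (1 - 1/5) (1 - 1/6) (1 - 1/4) = 1 - 1/2, and cost 5 * 6 * 4 = 120. *)
Lemma box_covering : covering P (maximal_boxes S) cell 2^-1 120.
Proof.
have mg := maximal_grid model.
have cov1 : covering m1 (maximal_boxes S) (fun I => cube_set (c1 I)) 5^-1 5.
  rewrite -[X in covering _ _ _ _ X]invrK; apply: laminar_covering => //.
    by move=> I _; exact: measurable_cube_set.
  by move=> I J /mg[? _ _] /mg[? _ _]; exact: (grid_laminar gridD1).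
have cov2 : covering m2 (maximal_boxes S) (fun I => cube_set (c2 I)) 6^-1 6.
  rewrite -[X in covering _ _ _ _ X]invrK; apply: laminar_covering => //.
    by move=> I _; exact: measurable_cube_set.
  by move=> I J /mg[_ ? _] /mg[_ ? _]; exact: (grid_laminar gridD2).
have cov3 : covering m3 (maximal_boxes S) (fun I => cube_set (c3 I)) 4^-1 4.
  rewrite -[X in covering _ _ _ _ X]invrK; apply: laminar_covering => //.
    by move=> I _; exact: measurable_cube_set.
  by move=> I J /mg[_ _ ?] /mg[_ _ ?]; exact: (grid_laminar gridD3).
(* The threshold 1/3 for the first two factors comes from (1 - 1/5) (1 - 1/6) = 2/3; with the third
   factor, (2/3) (1 - 1/4) = 1/2. *)
have cov12 : covering (m1 \x m2)%E (maximal_boxes S)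
    (fun I => cube_set (c1 I) `*` cube_set (c2 I)) 3^-1 (5 * 6).
  apply: product_covering cov1 cov2 => //; try lra.
  - move=> I _; split; first exact: measurable_cube_set.
    by have /andP[] := borel_leb_cube_fin (c1 I).
  - move=> I _; split; first exact: measurable_cube_set.
    exact: borel_leb_cube_fin.
rewrite (_ : 120 = 5 * 6 * 4); last by lra.
have [tau m] : (0 <= (4^-1 : R) < 1) /\ (3^-1 * (1 - 4^-1) <= 2^-1 - 4^-1 :> R).
  by split; lra.
have [M ME] := product_sigma_finite m1 m2.
rewrite -ME in cov12 *.
apply: product_covering tau m _ _ cov12 cov3 => //.
- move=> I _; split; first by apply: measurableX; exact: measurable_cube_set.
  rewrite ME product_measure1E/=; [|exact: measurable_cube_set..].
  by rewrite !borel_leb_cube ltry.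
- move=> I _; split; first exact: measurable_cube_set.
  exact: borel_leb_cube_fin.
Qed.

Lemma leb_covering (F : seq (box S)) (A : set (Rn R d1 * Rn R d2 * Rn R d3)) :
  {in F, forall I, maximal_boxes S I} -> measurable A ->
  {in F, forall I,
    ((2^-1)%:E * mu (box_set I) <= mu (box_set I `&` pt @^-1` A))%E} ->
  (mu (shadow [set` F]) <= 120%:E * mu (pt @^-1` A))%E.
Proof.
move=> FS mA hF.
have -> : shadow [set` F] = pt @^-1` (\bigcup_(I in [set` F]) cell I).
  by rewrite preimage_bigcup; apply: eq_bigcupr => I _; exact: box_setE.
have mF : measurable (\bigcup_(I in [set` F]) cell I).
  by apply: measurable_bigcup_seq => I _; exact: measurable_cell.
rewrite !leb_pt//; apply: box_covering => // I IF.
have := hF I IF; rewrite leb_box box_setE// -preimage_setI leb_pt//.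
by apply: measurableI => //; exact: measurable_cell.
Qed.

(** * The enlargement of a set of finite measure *)

Section Enlargement.
Variable Omega : set (ambient S).
Hypotheses (mOmega : measurable Omega) (Omega_fin : (mu Omega < +oo)%E).

Lemma enlargementP x : enlargement Omega x <-> exists I,
  [/\ maximal_boxes S I, box_set I x
    & ((2^-1)%:E * mu (box_set I) < mu (Omega `&` box_set I))%E].
Proof.
have avgE I : ((fine (mu (box_set I)))^-1%:E *
    \int[mu]_(y in box_set I) `|(\1_Omega y : R)|%:E =
    (fine (mu (box_set I)))^-1%:E * mu (Omega `&` box_set I))%E.
  congr (_ * _)%E; under eq_integral => y _ do rewrite ger0_norm//.
  by rewrite integral_indic//; exact: measurable_box_set.
have half I : ((2^-1)%:E * mu (box_set I) < mu (Omega `&` box_set I))%E =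
    ((2^-1)%:E < (fine (mu (box_set I)))^-1%:E * mu (Omega `&` box_set I))%E.
  have v0 : (0 < fine (mu (box_set I)))%R.
    by rewrite fine_gt0// leb_box P_cell_gt0 P_cell_lty.
  have vE : mu (box_set I) = (fine (mu (box_set I)))%:E.
    by rewrite fineK// ge0_fin_numE// leb_box P_cell_lty.
  have wfin : mu (Omega `&` box_set I) \is a fin_num.
    rewrite ge0_fin_numE//; apply: le_lt_trans Omega_fin.
    apply: le_measure; rewrite ?inE//.
    by apply: measurableI => //; exact: measurable_box_set.
  rewrite [X in (_ * X < _)%E]vE -(fineK wfin) -!EFinM !lte_fin.
  by rewrite -[in RHS](ltr_pM2r v0) mulrAC mulVf ?mul1r ?gt_eqF.
split.
  rewrite /enlargement /= /maximal_function => /ereal_sup_gt[_ [I [MI Ix] <-]].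
  by rewrite avgE -half; exists I.
move=> [I [MI Ix]]; rewrite half -avgE => h.
rewrite /enlargement /=; apply: lt_le_trans h _.
by apply: ereal_sup_ubound; exists I.
Qed.

Lemma maximal_sub_enlargement I : maximal_boxes S I -> box_set I `<=` Omega ->
  box_set I `<=` enlargement Omega.
Proof.
move=> MI IO x Ix; apply/enlargementP; exists I; split => //.
rewrite setIC setIidl//.
have := P_cell_gt0 I; have := P_cell_lty I; rewrite -leb_box.
case: (mu (box_set I)) => // r _; rewrite -EFinM !lte_fin; lra.
Qed.

(** Enclose [Omega] in a Borel set [A] of finite measure. The boxes at least half filled by [A]
    cover the enlargement, and by the covering estimate their union has measure at most
    [120 * P A]. *)
Lemma enlargement_bound : exists K : R,
  forall I, box_set I `<=` enlargement Omega -> (P (cell I) <= K%:E)%E.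
Proof.
have [A [mA OA Afin]] := outer_pt model Omega_fin.
pose G := [set I | maximal_boxes S I /\
  ((2^-1)%:E * P (cell I) <= P (cell I `&` A))%E].
have cG : countable G.
  by apply: sub_countable countable_boxes; apply: subset_card_le => I [].
have GU : (P (\bigcup_(I in G) cell I) <= 120%:E * P A)%E.
  apply: (covering_countable cG (D := maximal_boxes S)) => //.
  - by move=> I [].
  - by move=> I _; exact: measurable_cell.
  - exact: box_covering.
  - by move=> I [].
have mU : measurable (\bigcup_(I in G) cell I).
  have [->|/set0P G0] := eqVneq G set0; first by rewrite bigcup_set0.
  have [G0'|[g]] := elimT pfcard_geP cG; first by move: G0; rewrite G0' => -[].
  rewrite -(image_eq g) bigcup_image.
  by apply: bigcup_measurable => n _; exact: measurable_cell.
exists (120 * fine (P A)) => I IO.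
rewrite EFinM fineK ?ge0_fin_numE//; apply: le_trans GU.
apply: le_measure; rewrite ?inE//; first exact: measurable_cell.
apply: pt_sub; rewrite -box_setE// => x /IO/enlargementP[J [MJ Jx hJ]].
exists J; last by move: Jx; rewrite box_setE.
split=> //; move: hJ; rewrite leb_box => /ltW/le_trans; apply.
rewrite -leb_pt//; last by apply: measurableI => //; exact: measurable_cell.
apply: le_measure; rewrite ?inE.
- by apply: measurableI => //; exact: measurable_box_set.
- apply: measurable_pt => //; apply: measurableI => //; exact: measurable_cell.
- by move=> y [/OA Ay]; rewrite box_setE.
Qed.

(** The chain is k <= 2^k <= (2^k)^d <= K / v. *)
Lemma large_power (K v : R) : 0 < v -> exists n : nat, forall k d : nat,
  (0 < d)%N -> (2 ^+ k) ^+ d * v <= K -> (k <= n)%N.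
Proof.
move=> v0; exists (Num.bound (K / v)) => k d d0 hk.
have kK : k%:R <= K / v.
  rewrite ler_pdivlMr//; apply: le_trans hk; rewrite ler_wpM2r ?(ltW v0)//.
  apply: (@le_trans _ _ (2 ^+ k)).
    by rewrite -natrX ler_nat ltnW// ltn_expl.
  by rewrite ler_eXnr// exprn_ege1// ler1n.
rewrite -(ler_nat R); apply: (le_trans kK); apply: ltW.
by apply: le_lt_trans (archi_boundP _); rewrite ?ler_norm//; apply: le_trans kK.
Qed.

Lemma ancestor_side d (D : set (cube R d)) (Q : cube R d) k :
  dyadic_grid D -> D Q -> side (ancestor D Q k) = 2 ^+ k * side Q.
Proof.
move=> gD DQ; have [_ _ lvl] := ancestorP gD k DQ.
by rewrite /side lvl expfzDr.
Qed.

(** The maximum defining [emb1] is attained: [k = 0] qualifies because the box lies in [Omega], and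
    the measure of [ext1 I k] grows without bound while boxes inside the enlargement have bounded
    measure. *)
Lemma emb1P I : rectangles S I -> box_set I `<=` Omega ->
  ~ (box_set (ext1 I (emb1 I Omega).+1) `<=` enlargement Omega).
Proof.
move=> RI IO; have [I1 I2 I3] := maximal_grid model (rectangle_maximal model RI).
have [K hK] := enlargement_bound.
have v0 : 0 < side (c1 I) ^+ d1 * side (c2 I) ^+ d2 * side (c3 I) ^+ d3.
  by rewrite !mulr_gt0// exprn_gt0// side_gt0.
have [n hn] := large_power K v0.
have [] := @max_natP [set k | box_set (ext1 I k) `<=` enlargement Omega] n.
- apply: maximal_sub_enlargement; first exact: ext1_maximal.
  apply: subset_trans IO; rewrite !box_setE// cell_ext1//.
  suff -> : ancestor D1 (c1 I) 0 = c1 I by [].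
  have [A1 A2 A3] := ancestorP gridD1 0 I1.
  apply: (grid_eq gridD1 A1 I1 _ (A2 _ (cube_set_corner _)))=> //.
    by rewrite A3 add0r.
  exact: cube_set_corner.
- move=> k /hK; rewrite cell_ext1// P_cubes lee_fin ancestor_side//.
  by rewrite exprMn -!mulrA => hk; apply: (hn k d1 d1_gt0); rewrite -!mulrA.
- by move=> _ hmax /hmax; rewrite ltnn.
Qed.

Lemma emb2P I : rectangles S I -> box_set I `<=` Omega ->
  ~ (box_set (ext2 I (emb2 I Omega).+1) `<=` enlargement Omega).
Proof.
move=> RI IO; have [I1 I2 I3] := maximal_grid model (rectangle_maximal model RI).
have [K hK] := enlargement_bound.
have v0 : 0 < side (c1 I) ^+ d1 * side (c2 I) ^+ d2 * side (c3 I) ^+ d3.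
  by rewrite !mulr_gt0// exprn_gt0// side_gt0.
have [n hn] := large_power K v0.
have [] := @max_natP [set k | box_set (ext2 I k) `<=` enlargement Omega] n.
- apply: maximal_sub_enlargement; first exact: ext2_maximal.
  apply: subset_trans IO; rewrite !box_setE// cell_ext2//.
  suff -> : ancestor D2 (c2 I) 0 = c2 I by [].
  have [A1 A2 A3] := ancestorP gridD2 0 I2.
  apply: (grid_eq gridD2 A1 I2 _ (A2 _ (cube_set_corner _)))=> //.
    by rewrite A3 add0r.
  exact: cube_set_corner.
- move=> k /hK; rewrite cell_ext2// P_cubes lee_fin ancestor_side//.
  rewrite exprMn (mulrCA (side (c1 I) ^+ d1)) -!mulrA => hk.
  by apply: (hn k d2 d2_gt0); rewrite -!mulrA.
- by move=> _ hmax /hmax; rewrite ltnn.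
Qed.

End Enlargement.

(** * Good halves of the rectangles of an admissible pair *)

Section Admissible.
Variables (Omega : set (ambient S)) (U : set (box S)).
Hypothesis admU : admissible Omega U.

Let mOmega : measurable Omega. Proof. by have [] := admU. Qed.
Let Omega_fin : (mu Omega < +oo)%E. Proof. by have [] := admU. Qed.
Let UR I : U I -> rectangles S I.
Proof. by have [_ _ + _ _] := admU; apply. Qed.
Let UO I : U I -> box_set I `<=` Omega.
Proof. by have [_ _ _ + _] := admU; apply. Qed.
Let UG I : U I -> [/\ D1 (c1 I), D2 (c2 I) & D3 (c3 I)].
Proof. by move=> /UR/(rectangle_maximal model)/(maximal_grid model). Qed.

Lemma not_sub_enlargement I : maximal_boxes S I ->
  ~ (box_set I `<=` enlargement Omega) ->
  (mu (Omega `&` box_set I) <= (2^-1)%:E * P (cell I))%E.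
Proof.
move=> MI nsub; rewrite leNgt; apply/negP => lt_I; apply: nsub => x Ix.
by apply/(enlargementP mOmega Omega_fin); exists I; split=> //; rewrite leb_box.
Qed.

Lemma half_good (a b v : \bar R) : (v < +oo)%E -> (0 <= a)%E -> (0 <= b)%E ->
  v = (a + b)%E -> (a <= (2^-1)%:E * v)%E -> ((2^-1)%:E * v <= b)%E.
Proof.
move=> + + + vE; rewrite {}vE.
by case: a b => [a| |] [b| |] //= _ _ _; rewrite -EFinD -!EFinM !lee_fin; lra.
Qed.

Variable F : seq (box S).
Hypothesis FU : {in F, forall I, U I}.

(** Let [Q1] be the first ancestor whose box leaves the enlargement. The product of [Q1] with the
    bad set lies in [Omega], so it has at most half the measure of that box; dividing by the measure
    of [Q1] bounds the bad set. *)
Lemma good1_half I : I \in F ->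
  ((2^-1)%:E * (m2 (cube_set (c2 I)) * m3 (cube_set (c3 I))) <=
   (m2 \x m3) (good1 F (fun J => cube_set (c1 J)) (fun J => cube_set (c2 J))
     (fun J => cube_set (c3 J)) (fun J => (c1 J).2)
     (fun J => emb1 J Omega) I))%E.
Proof.
move=> IF; have UI := FU IF; have [I1 I2 I3] := UG UI.
set good := good1 _ _ _ _ _ _ _; set k := (emb1 I Omega).+1.
pose Q1 := ancestor D1 (c1 I) k.
have [DQ1 IQ1 lvlQ1] := ancestorP gridD1 k I1.
have mg : measurable good.
  apply: (measurable_good1 _ _ _ (m2 := m2) (m3 := m3)) => // J _; split;
    do ?exact: measurable_cube_set.
    by have /andP[] := borel_leb_cube_fin (c2 J).
  exact: borel_leb_cube_fin.
have m23 : measurable (cube_set (c2 I) `*` cube_set (c3 I)).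
  by apply: measurableX; exact: measurable_cube_set.
pose bad := (cube_set (c2 I) `*` cube_set (c3 I)) `\` good.
have mbad : measurable bad by exact: measurableD.
have m23E : ((m2 \x m3) (cube_set (c2 I) `*` cube_set (c3 I)) =
    m2 (cube_set (c2 I)) * m3 (cube_set (c3 I)))%E.
  by rewrite product_measure1E//; exact: measurable_cube_set.
rewrite -m23E; apply: (@half_good ((m2 \x m3)%E bad)) => //.
- by rewrite m23E !borel_leb_cube ltry.
- rewrite -measureU//; last by rewrite setIC setDIK.
  congr ((m2 \x m3)%E _); rewrite setUC setDUK// => y [].
  by move=> ? ? _; split.
have mQ1 := measurable_cube_set Q1.
have := @product_cyl1 _ _ _ _ _ _ _ m1 m2 m3 _ _ mQ1 mbad.
set cyl := cyl1 _ _ => cylE.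
have mcyl : measurable cyl by exact: measurable_cyl1.
(* The first side of a [J] that makes the point bad is longer than that of [I] by at least [k]
   levels and contains it, so it contains [Q1]; the point then lies in [J], hence in [Omega]. *)
have cylO : pt @^-1` cyl `<=` Omega `&` box_set (ext1 I k).
  move=> x [Q1x [[c2x c3x] nx]]; split; last first.
    by rewrite box_setE// /= cell_ext1.
  apply: contrapT => nOx; apply: nx; split=> // J JF c1IJ c2J c3J.
  rewrite leNgt; apply/negP => ltJ; apply: nOx.
  have [J1 J2 J3] := UG (FU JF); apply: (UO (FU JF)).
  rewrite box_setE//; split; [split|] => //.
  apply: (grid_nested gridD1 DQ1 J1 (IQ1 _ (cube_set_corner _)) _ _ Q1x).
    exact: c1IJ (cube_set_corner _).
  by rewrite lvlQ1; move: ltJ; rewrite /k; clear; lia.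
have mext : measurable (Omega `&` box_set (ext1 I k)).
  by apply: measurableI => //; exact: measurable_box_set.
have : (P cyl <= (2^-1)%:E * P (cell (ext1 I k)))%E.
  rewrite -leb_pt//; apply: (@le_trans _ _ (mu (Omega `&` box_set (ext1 I k)))).
    by apply: le_measure; rewrite ?inE//; exact: measurable_pt.
  apply: not_sub_enlargement; first by apply: ext1_maximal => //; exact: UR.
  by apply: emb1P => //; [exact: UR|exact: UO].
rewrite cylE cell_ext1// -/Q1 P_prod; [|exact: measurable_cube_set..].
have /andP[Q10 Q1oo] := borel_leb_cube_fin Q1.
rewrite /= -muleA (muleCA (2^-1)%:E) lee_pmul2l ?ge0_fin_numE//.
by rewrite m23E.
Qed.

(** The argument of [good1_half] with the first two factors exchanged. *)
Lemma good2_half I : I \in F ->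
  ((2^-1)%:E * (m1 (cube_set (c1 I)) * m3 (cube_set (c3 I))) <=
   (m1 \x m3) (good2 F (fun J => cube_set (c1 J)) (fun J => cube_set (c2 J))
     (fun J => cube_set (c3 J)) (fun J => (c2 J).2)
     (fun J => emb2 J Omega) I))%E.
Proof.
move=> IF; have UI := FU IF; have [I1 I2 I3] := UG UI.
set good := good2 _ _ _ _ _ _ _; set k := (emb2 I Omega).+1.
pose Q2 := ancestor D2 (c2 I) k.
have [DQ2 IQ2 lvlQ2] := ancestorP gridD2 k I2.
have mg : measurable good.
  apply: (measurable_good2 _ _ _ (m1 := m1) (m3 := m3)) => // J _; split;
    do ?exact: measurable_cube_set.
    by have /andP[] := borel_leb_cube_fin (c1 J).
  exact: borel_leb_cube_fin.
have m13 : measurable (cube_set (c1 I) `*` cube_set (c3 I)).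
  by apply: measurableX; exact: measurable_cube_set.
pose bad := (cube_set (c1 I) `*` cube_set (c3 I)) `\` good.
have mbad : measurable bad by exact: measurableD.
have m13E : ((m1 \x m3) (cube_set (c1 I) `*` cube_set (c3 I)) =
    m1 (cube_set (c1 I)) * m3 (cube_set (c3 I)))%E.
  by rewrite product_measure1E//; exact: measurable_cube_set.
rewrite -m13E; apply: (@half_good ((m1 \x m3)%E bad)) => //.
- by rewrite m13E !borel_leb_cube ltry.
- rewrite -measureU//; last by rewrite setIC setDIK.
  congr ((m1 \x m3)%E _); rewrite setUC setDUK// => y [].
  by move=> ? ? _; split.
have mQ2 := measurable_cube_set Q2.
have := @product_cyl2 _ _ _ _ _ _ _ m1 m2 m3 _ _ mQ2 mbad.
set cyl := cyl2 _ _ => cylE.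
have mcyl : measurable cyl by exact: measurable_cyl2.
have cylO : pt @^-1` cyl `<=` Omega `&` box_set (ext2 I k).
  move=> x [Q2x [[c1x c3x] nx]]; split; last first.
    by rewrite box_setE// /= cell_ext2.
  apply: contrapT => nOx; apply: nx; split=> // J JF c2IJ c1J c3J.
  rewrite leNgt; apply/negP => ltJ; apply: nOx.
  have [J1 J2 J3] := UG (FU JF); apply: (UO (FU JF)).
  rewrite box_setE//; split; [split|] => //.
  apply: (grid_nested gridD2 DQ2 J2 (IQ2 _ (cube_set_corner _)) _ _ Q2x).
    exact: c2IJ (cube_set_corner _).
  by rewrite lvlQ2; move: ltJ; rewrite /k; clear; lia.
have mext : measurable (Omega `&` box_set (ext2 I k)).
  by apply: measurableI => //; exact: measurable_box_set.
have : (P cyl <= (2^-1)%:E * P (cell (ext2 I k)))%E.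
  rewrite -leb_pt//; apply: (@le_trans _ _ (mu (Omega `&` box_set (ext2 I k)))).
    by apply: le_measure; rewrite ?inE//; exact: measurable_pt.
  apply: not_sub_enlargement; first by apply: ext2_maximal => //; exact: UR.
  by apply: emb2P => //; [exact: UR|exact: UO].
rewrite cylE cell_ext2// -/Q2 P_prod; [|exact: measurable_cube_set..].
have /andP[Q20 Q2oo] := borel_leb_cube_fin Q2.
rewrite /= (muleC (m1 _)) -muleA (muleCA (2^-1)%:E) lee_pmul2l ?ge0_fin_numE//.
by rewrite m13E.
Qed.

Variables (w : nat -> nat -> R) (Gamma : R).
Hypothesis w12 : W12 w.
Hypothesis w_ft : forall N, \sum_(k < N.+1) w k (N - k)%N <= Gamma.
Hypothesis uniqF : uniq F.

Lemma finite_embedding :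
  (\sum_(I <- F) (W_weight w I Omega)%:E * mu (box_set I) <=
   (8 * Gamma)%:E * mu (shadow [set` F]))%E.
Proof.
have [w0 w1 w2] := w12; have [_ _ _ _ Uinc] := admU.
have -> : shadow [set` F] = pt @^-1` (\bigcup_(I in [set` F]) cell I).
  by rewrite preimage_bigcup; apply: eq_bigcupr => I _; exact: box_setE.
rewrite leb_pt//; last first.
  by apply: measurable_bigcup_seq => I _; exact: measurable_cell.
under eq_bigr do rewrite leb_box.
apply: (embedding_bound (m1 := m1) (m2 := m2) (m3 := m3)
  (c1 := fun I => cube_set (c1 I)) (c2 := fun I => cube_set (c2 I))
  (c3 := fun I => cube_set (c3 I)) (s := fun I => (c1 I).2)
  (t := fun I => (c2 I).2) (a := fun I => emb1 I Omega)
  (b := fun I => emb2 I Omega)) => //.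
- move=> I _; split; first exact: measurable_cube_set.
  by have /andP[] := borel_leb_cube_fin (c1 I).
- move=> I _; split; first exact: measurable_cube_set.
  by have /andP[] := borel_leb_cube_fin (c2 I).
- move=> I _; split; first exact: measurable_cube_set.
  exact: borel_leb_cube_fin.
- move=> I J /FU/UG[I1 _ _] /FU/UG[J1 _ _] x Ix Jx.
  exact (grid_nested gridD1 I1 J1 Ix Jx).
- move=> I J /FU/UG[_ I2 _] /FU/UG[_ J2 _] x Ix Jx.
  exact (grid_nested gridD2 I2 J2 Ix Jx).
- move=> I J /FU UI /FU UJ x Ix Jx IJ.
  have [_ _ I3] := UG UI; have [_ _ J3] := UG UJ.
  have lvl : (c3 I).2 <= (c3 J).2.
    by rewrite !(rectangle_level model)//; exact: UR.
  exact (grid_nested gridD3 I3 J3 Ix Jx lvl).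
- move=> I J /FU UI /FU UJ IJ; apply: Uinc => //.
  by rewrite !box_setE// => x; exact: IJ.
- exact: good1_half.
- exact: good2_half.
- by move=> k l k' l' kk' ll'; apply: le_trans (w1 _ _ _ kk') (w2 _ _ _ ll').
Qed.

End Admissible.

Lemma rectangles_countable (U : set (box S)) : U `<=` rectangles S ->
  countable U.
Proof.
move=> UR; apply: sub_countable countable_boxes.
by apply: subset_card_le => I /UR; exact: rectangle_maximal.
Qed.

(** The factor 2 pays for passing to a finite subfamily, [8 * Gamma] for bounding its sum by its
    shadow, and 120 for replacing that shadow by the one of the greedy selection. *)
Lemma sparse_subfamily (w : nat -> nat -> R) (Gamma : R) (Omega : set (ambient S))
    (U : set (box S)) : W12 w ->
  (forall N, \sum_(k < N.+1) w k (N - k)%N <= Gamma) -> admissible Omega U ->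
  exists G : set (box S), [/\ G `<=` U, sparse 8^-1 G
    & (\int[mu]_(x in Omega) H_fun w Omega U x <=
       2%:E * ((8 * Gamma)%:E * (120%:E * mu (shadow G))))%E].
Proof.
move=> w12 w_ft admU; have [w0 _ _] := w12.
have Gamma0 : 0 <= Gamma.
  by apply: le_trans (w_ft 0); rewrite big_ord_recl big_ord0 addr0.
have [mO Ofin UR UO _] := admU.
have UM I : U I -> maximal_boxes S I by move=> /UR; exact: rectangle_maximal.
rewrite integral_H//; last 2 first.
- exact: rectangles_countable.
- by move=> I _; exact: measurable_box_set.
set total := esum _ _.
have total0 : (0 <= total)%E.
  by apply: esum_ge0 => I _; rewrite mule_ge0 ?lee_fin ?w0.
have finite_sum (X : set (box S)) : fsets U X ->
  (\sum_(I \in X) (W_weight w I Omega)%:E * mu (box_set I) <=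
   (8 * Gamma)%:E * mu (shadow [set` finmap.enum_fset (fset_set X)]))%E.
  move=> [Xfin XU]; rewrite fsbig_finite//=.
  apply: (finite_embedding admU) => //.
  by move=> I; rewrite in_fset_set// inE; exact: XU.
have shU (F : seq (box S)) : {in F, forall I, U I} ->
    measurable (shadow [set` F]) /\ shadow [set` F] `<=` Omega.
  move=> FU; split.
    by apply: measurable_bigcup_seq => I _; exact: measurable_box_set.
  by move=> x [I /= /FU UI Ix]; exact: UO UI x Ix.
(* Every finite partial sum is at most [8 * Gamma] times the measure of [Omega]. Finiteness is what
   allows a finite subfamily to carry more than half of the total. *)
have total_fin : (total < +oo)%E.
  apply: (@le_lt_trans _ _ ((8 * Gamma)%:E * mu Omega)%E); last first.
    by rewrite lte_mul_pinfty// lee_fin mulr_ge0.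
  apply: ge_ereal_sup => _ [X XU <-]; apply: le_trans (finite_sum X XU) _.
  rewrite lee_wpmul2l ?lee_fin ?mulr_ge0//.
  have [|mX XO] := shU (finmap.enum_fset (fset_set X)).
    by move=> I; case: XU => Xfin XU; rewrite in_fset_set// inE; exact: XU.
  by apply: le_measure; rewrite ?inE.
(* Half of the total lies strictly below it only when the total is positive; for total 0 the empty
   family serves. *)
have [->|total_neq0] := eqVneq total 0%E.
  exists set0; split; [exact: sub0set| |].
    by exists (fun=> set0); split=> [I J []|I []].
  by rewrite !mule_ge0 ?lee_fin ?mulr_ge0.
have total_gt0 : (0 < total)%E by rewrite lt_def total_neq0 total0.
have totalE : total = (fine total)%:E by rewrite fineK// ge0_fin_numE.
have : 2^-1 * fine total < fine total.
  have : 0 < fine total by rewrite fine_gt0// total_gt0.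
  lra.
rewrite -lte_fin -totalE => /ereal_sup_gt[_ [X XU <-]] ltX.
have FU : {in finmap.enum_fset (fset_set X), forall I, U I}.
  by move=> I; case: XU => Xfin XU; rewrite in_fset_set// inE; exact: XU.
have [|G [GF spG GI]] := greedy_sparse (F := finmap.enum_fset (fset_set X)).
  by move=> I _; split; [exact: measurable_box_set|rewrite leb_box P_cell_lty].
have GU : {in G, forall I, U I} by move=> I /GF; exact: FU.
exists [set` G]; split; first exact: GU.
  (* The selection is even 1/2-sparse, which is weakened to 1/8. *)
  have [E [triE hE]] := spG; exists E; split=> // I IG.
  have [mE EI hI] := hE I IG; split=> //; apply: le_trans hI.
  have := P_cell_lty I; have := P_cell_gt0 I; rewrite leb_box.
  by case: (P _) => //= r; rewrite -!EFinM lee_fin !lte_fin; lra.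
have shGE : shadow [set` G] = pt @^-1` (\bigcup_(I in [set` G]) cell I).
  by rewrite preimage_bigcup; apply: eq_bigcupr => I _; exact: box_setE.
have shFG : (mu (shadow [set` finmap.enum_fset (fset_set X)]) <=
    120%:E * mu (shadow [set` G]))%E.
  rewrite [in leRHS]shGE; apply: leb_covering => //.
  - by move=> I /FU; exact: UM.
  - by apply: measurable_bigcup_seq => I _; exact: measurable_cell.
  - by rewrite -shGE.
apply: (@le_trans _ _ (2%:E * (2^-1 * fine total)%:E)%E).
  by rewrite -EFinM mulrA divff// mul1r -totalE.
rewrite lee_wpmul2l ?lee_fin//; apply: (le_trans (ltW ltX)).
apply: le_trans (finite_sum X XU) _.
by rewrite lee_wpmul2l ?lee_fin ?mulr_ge0.
Qed.

(** For each [k <= N], every point of the test set lies in a rectangle of [U] with embedding numbers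
    [k] and [N - k]. Hence [H_fun] is at least the antidiagonal sum throughout [Omega], and
    integration gives the bound. *)
Lemma ft_le_embedding_constant (w : nat -> nat -> R) (C : R) (N : nat) :
  W12 w -> embedding_constant S w C -> \sum_(k < N.+1) w k (N - k)%N <= C.
Proof.
move=> [w0 _ _] embC.
pose z1 : Rn R d1 := [tuple of nseq d1 0].
pose z2 : Rn R d2 := [tuple of nseq d2 0].
pose z3 : Rn R d3 := [tuple of nseq d3 0].
have [Q1 [DQ1 Q1lvl Q1z]] := grid_cover gridD1 0 z1.
have [Q2 [DQ2 Q2lvl Q2z]] := grid_cover gridD2 0 z2.
(* The levels [- k] and [k - N] add up to [- N] for every [k], so all the test rectangles share the
   third side [Q3]. *)
have [Q3 [DQ3 Q3lvl Q3z]] := grid_cover gridD3 (- N%:Z) z3.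
pose Q := cube_set Q1 `*` cube_set Q2 `*` cube_set Q3.
pose Omega := pt @^-1` Q.
have mQ : measurable Q.
  by apply: measurableX; [apply: measurableX|]; exact: measurable_cube_set.
have mO : measurable Omega by exact: measurable_pt.
have muO : mu Omega = P Q by exact: leb_pt.
have Ofin : (mu Omega < +oo)%E by rewrite muO P_cubes ltry.
have Ogt0 : (0 < mu Omega)%E.
  by rewrite muO P_cubes lte_fin !mulr_gt0// exprn_gt0// side_gt0.
pose inU (k : nat) I := [/\ rectangles S I, (c1 I).2 = - k%:Z,
  (c2 I).2 = k%:Z - N%:Z, c3 I = Q3 &
  cube_set (c1 I) `<=` cube_set Q1 /\ cube_set (c2 I) `<=` cube_set Q2].
pose U := [set I | exists2 k, (k <= N)%N & inU k I].
have UO I : U I -> box_set I `<=` Omega.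
  move=> [k _ [_ _ _ I3 [I1 I2]]] x; rewrite box_setE//.
  by move=> [[x1 x2] x3]; split; [split; [exact: I1|exact: I2]|rewrite -I3].
have grid_of I : rectangles S I -> [/\ D1 (c1 I), D2 (c2 I) & D3 (c3 I)].
  by move=> RI; exact/(maximal_grid model)/(rectangle_maximal model).
have admU : admissible Omega U.
  split=> //; first by move=> I [k _ []].
  move=> I J [k kN [RI I1 I2 I3 [_ _]]] [l lN [RJ J1 J2 J3 [_ _]]] IJ.
  have [IJ1 IJ2 _] := box_sub IJ.
  have [DI1 DI2 _] := grid_of I RI; have [DJ1 DJ2 _] := grid_of J RJ.
  have := cube_set_level d1_gt0 IJ1; have := cube_set_level d2_gt0 IJ2.
  (* fake *)
  rewrite I1 I2 J1 J2 => h2 h1.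
  have kl : k = l by move: h1 h2; clear; lia.
  have c1I := cube_set_corner (c1 I); have c2I := cube_set_corner (c2 I).
  apply: (coord_inj model); last by rewrite I3.
    by apply: (grid_eq gridD1 DI1 DJ1 _ c1I (IJ1 _ c1I)); rewrite I1 J1 kl.
  by apply: (grid_eq gridD2 DI2 DJ2 _ c2I (IJ2 _ c2I)); rewrite I2 J2 kl.
(* If some side of [J] is not contained in the corresponding side of [Q], then by [grid_half] the
   latter has at most half its measure, so [Q] fills at most half of [J]. *)
have enl_sub : enlargement Omega `<=` Omega.
  move=> x /(enlargementP mO Ofin)[J [MJ]].
  rewrite leb_box box_setE// => Jx hJ.
  have [DJ1 DJ2 DJ3] := maximal_grid model MJ.
  have mJ := measurable_cell J.
  have {}hJ : ((2^-1)%:E * P (cell J) < P (Q `&` cell J))%E.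
    by move: hJ; rewrite -preimage_setI leb_pt//; exact: measurableI.
  have /set0P[y [[[Qy1 Qy2] Qy3] [[Jy1 Jy2] Jy3]]] : Q `&` cell J != set0.
    by apply: contraTneq hJ => ->; rewrite measure0 -leNgt mule_ge0.
  have big A1 A2 A3 : (P (cube_set A1 `*` cube_set A2 `*` cube_set A3) <=
      (2^-1)%:E * P (cell J))%E ->
      ~ (Q `&` cell J `<=` cube_set A1 `*` cube_set A2 `*` cube_set A3).
    move=> le_A QJ; move: hJ; rewrite ltNge => /negP; apply.
    apply: le_trans le_A; apply: le_measure; rewrite ?inE//.
      exact: measurableI.
    by apply: measurableX; [apply: measurableX|]; exact: measurable_cube_set.
  have [a1 a2 a3] : [/\ 0 <= side (c1 J) ^+ d1, 0 <= side (c2 J) ^+ d2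
      & 0 <= side (c3 J) ^+ d3] by split; rewrite exprn_ge0// side_ge0.
  move: Jx => [[Jx1 Jx2] Jx3].
  have [J1|] := grid_half gridD1 DJ1 DQ1 Jy1 Qy1; last first.
    rewrite !borel_leb_cube -EFinM lee_fin => h; exfalso.
    apply: (@big Q1 (c2 J) (c3 J)); last by move=> z [[[? _] _] [[_ ?] ?]].
    by rewrite !P_cubes -EFinM lee_fin !mulrA !ler_wpM2r.
  have [J2|] := grid_half gridD2 DJ2 DQ2 Jy2 Qy2; last first.
    rewrite !borel_leb_cube -EFinM lee_fin => h; exfalso.
    apply: (@big (c1 J) Q2 (c3 J)); last by move=> z [[[_ ?] _] [[? _] ?]].
    by rewrite !P_cubes -EFinM lee_fin mulrA mulrCA ler_wpM2r// ler_wpM2l.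
  have [J3|] := grid_half gridD3 DJ3 DQ3 Jy3 Qy3; last first.
    rewrite !borel_leb_cube -EFinM lee_fin => h; exfalso.
    apply: (@big (c1 J) (c2 J) Q3); last by move=> z [[_ ?] [[? ?] _]].
    by rewrite !P_cubes -EFinM lee_fin mulrCA ler_wpM2l ?mulr_ge0.
  by split; [split; [exact: J1|exact: J2]|exact: J3].
have emb1E k I : (k <= N)%N -> inU k I -> emb1 I Omega = k.
  move=> kN [RI I1 I2 I3 [IQ1 IQ2]]; have [DI1 DI2 DI3] := grid_of I RI.
  apply: max_natE => [|l].
    apply: (maximal_sub_enlargement mO Ofin); first exact: ext1_maximal.
    have [DA IA lvlA] := ancestorP gridD1 k DI1.
    rewrite box_setE// cell_ext1// => x [[/= x1 x2] x3].
    split; [split|by rewrite -I3]; last exact: IQ2.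
    have c1I := cube_set_corner (c1 I).
    apply: (grid_nested gridD1 DA DQ1 (IA _ c1I) (IQ1 _ c1I) _ x1).
    by rewrite lvlA I1 Q1lvl addrN.
  move=> /subset_trans/(_ enl_sub); rewrite box_setE// => /pt_sub.
  rewrite cell_ext1// => sub.
  have [_ _ lvlA] := ancestorP gridD1 l DI1.
  suff : (ancestor D1 (c1 I) l).2 <= Q1.2.
    by rewrite lvlA I1 Q1lvl; clear; lia.
  apply: cube_set_level => // x Ax.
  by have [] := sub (x, (c2 I).1, (c3 I).1)
    (conj (conj Ax (cube_set_corner _)) (cube_set_corner _)); case.
have emb2E k I : (k <= N)%N -> inU k I -> emb2 I Omega = (N - k)%N.
  move=> kN [RI I1 I2 I3 [IQ1 IQ2]]; have [DI1 DI2 DI3] := grid_of I RI.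
  apply: max_natE => [|l].
    apply: (maximal_sub_enlargement mO Ofin); first exact: ext2_maximal.
    have [DA IA lvlA] := ancestorP gridD2 (N - k)%N DI2.
    rewrite box_setE// cell_ext2// => x [[/= x1 x2] x3].
    split; [split|by rewrite -I3]; first exact: IQ1.
    have c2I := cube_set_corner (c2 I).
    apply: (grid_nested gridD2 DA DQ2 (IA _ c2I) (IQ2 _ c2I) _ x2).
    by rewrite lvlA I2 Q2lvl; move: kN; clear; lia.
  move=> /subset_trans/(_ enl_sub); rewrite box_setE// => /pt_sub.
  rewrite cell_ext2// => sub.
  have [_ _ lvlA] := ancestorP gridD2 l DI2.
  suff : (ancestor D2 (c2 I) l).2 <= Q2.2.
    by rewrite lvlA I2 Q2lvl; move: kN; clear; lia.
  apply: cube_set_level => // x Ax.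
  by have [] := sub ((c1 I).1, x, (c3 I).1)
    (conj (conj (cube_set_corner _) Ax) (cube_set_corner _)); case.
have H_ge x : Omega x ->
    ((\sum_(k < N.+1) w k (N - k)%N)%:E <= H_fun w Omega U x)%E.
  move=> [[x1 x2] x3].
  have /choice[f fP] (k : 'I_N.+1) : exists I, inU k I /\ box_set I x.
    have kN : (k <= N)%N by rewrite -ltnS.
    have [A1 [DA1 A1lvl A1x]] := grid_cover gridD1 (- (k : nat)%:Z) (pt x).1.1.
    have [A2 [DA2 A2lvl A2x]] :=
      grid_cover gridD2 ((k : nat)%:Z - N%:Z) (pt x).1.2.
    have [|I [RI I1 I2 I3]] := rectangle_with model DA1 DA2 DQ3.
      by rewrite Q3lvl A1lvl A2lvl; clear; lia.
    exists I; split; last by rewrite box_setE//; split; [split|];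
      rewrite ?I1 ?I2 ?I3.
    split=> //; rewrite ?I1 ?I2//; split.
      by apply: (grid_nested gridD1 DA1 DQ1 A1x x1);
        rewrite A1lvl Q1lvl; clear; lia.
    by apply: (grid_nested gridD2 DA2 DQ2 A2x x2);
      rewrite A2lvl Q2lvl; move: kN; clear; lia.
  have finj : injective f.
    move=> k l fkl; have [[_ lk _ _ _] _] := fP k; have [[_ ll _ _ _] _] := fP l.
    by apply/val_inj; move: lk ll; rewrite fkl => -> /oppr_inj [].
  apply: esum_ge; exists [set` map f (enum 'I_N.+1)].
    split=> // _ /mapP[k _ ->]; exists k; first by rewrite -ltnS.
    by have [] := fP k.
  rewrite -fsbig_seq; last by rewrite map_inj_uniq ?enum_uniq.
  rewrite big_map big_enum/= -sumEFin; apply: lee_sum => k _.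
  have [inUk fkx] := fP k; have kN : (k <= N)%N by rewrite -ltnS.
  by rewrite /W_weight (emb1E k)// (emb2E k)// indicE mem_set// mulr1.
have := embC Omega U admU; apply: contraPP => /negP; rewrite -ltNge => ltC.
apply/negP; rewrite -ltNge.
(* Strictness survives integration because [Omega] has positive finite measure. *)
apply: (@lt_le_trans _ _ (\int[mu]_(x in Omega)
    (cst (\sum_(k < N.+1) w k (N - k)%N)%:E x))%E).
  by rewrite integral_cst// lte_pmul2r ?ge0_fin_numE.
apply: ge0_le_integral => //.
- by move=> x _; rewrite lee_fin sumr_ge0.
- apply: (@measurable_funS _ _ _ _ setT) => //.
  apply: measurable_H => //; first by apply: rectangles_countable => I [k _ []].
  by move=> I _; exact: measurable_box_set.
Qed.

Theorem model_bounds (w : nat -> nat -> R) : W12 w ->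
  [/\ (forall (Omega : set (ambient S)) (U : set (box S)), admissible Omega U ->
        (\int[mu]_(x in Omega) H_fun w Omega U x =
         \esum_(I in U) ((W_weight w I Omega)%:E * mu (box_set I)))%E),
      (exists C : R, embedding_constant S w C) <-> (ft_norm w < +oo)%E,
      (ft_norm w <= optimal_constant S w <= 2560%:E * ft_norm w)%E
    & (ft_norm w < +oo)%E ->
      forall (Omega : set (ambient S)) (U : set (box S)), admissible Omega U ->
      exists G0 : set (box S),
        [/\ G0 `<=` U, sparse 8^-1 G0
          & (\int[mu]_(x in Omega) H_fun w Omega U x <=
             2560%:E * ft_norm w * mu (shadow G0))%E]].
Proof.
move=> w12; have [w0 _ _] := w12.
have ft_ge0 : (0 <= ft_norm w)%E.
  apply: le_trans (ereal_sup_ubound _); last by exists 0%N.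
  by rewrite lee_fin sumr_ge0.
have ft_le C : embedding_constant S w C -> (ft_norm w <= C%:E)%E.
  move=> embC; apply: ge_ereal_sup => _ [N _ <-].
  by rewrite lee_fin; exact: ft_le_embedding_constant.
have sparse_ft : (ft_norm w < +oo)%E ->
    forall (Omega : set (ambient S)) (U : set (box S)), admissible Omega U ->
    exists G0 : set (box S), [/\ G0 `<=` U, sparse 8^-1 G0
      & (\int[mu]_(x in Omega) H_fun w Omega U x <=
         2560%:E * ft_norm w * mu (shadow G0))%E].
  move=> ft_fin Omega U admU.
  have [g gE] : exists g : R, ft_norm w = g%:E.
    by exists (fine (ft_norm w)); rewrite fineK// ge0_fin_numE.
  have g0 : 0 <= g by rewrite -lee_fin -gE.
  have [|G [GU spG HG]] := @sparse_subfamily w g Omega U w12 _ admU.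
    by move=> N; rewrite -lee_fin -gE; apply: ereal_sup_ubound; exists N.
  exists G; split; [exact: GU|exact: spG|apply: (le_trans HG)].
  rewrite gE !muleA -!EFinM; apply: lee_pmul; rewrite ?lee_fin ?mulr_ge0//.
  by lra.
have emb_ft : (ft_norm w < +oo)%E ->
    embedding_constant S w (2560 * fine (ft_norm w)).
  move=> ft_fin Omega U admU; have [mO _ UR UO _] := admU.
  have [G [GU _ HG]] := sparse_ft ft_fin Omega U admU.
  rewrite EFinM fineK; last by rewrite ge0_fin_numE.
  have : (0 <= 2560%:E * ft_norm w)%E.
    by apply: mule_ge0; [rewrite lee_fin; exact: ler0n|exact: ft_ge0].
  move: (2560%:E * ft_norm w)%E HG => K HG K0; apply: (le_trans HG).
  rewrite lee_wpmul2l//; apply: le_measure; rewrite ?inE//; last first.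
    by move=> x [I /GU/UO]; apply.
  have cG : countable G by apply: rectangles_countable => I /GU/UR.
  have [->|[g]] := elimT pfcard_geP cG; first by rewrite /shadow bigcup_set0.
  rewrite /shadow -(image_eq g) bigcup_image.
  by apply: bigcup_measurable => n _; exact: measurable_box_set.
split; last exact: sparse_ft.
- move=> Omega U [mO _ UR UO _]; apply: integral_H => //.
    exact: rectangles_countable.
  by move=> I _; exact: measurable_box_set.
- split=> [[C /ft_le/le_lt_trans]|/emb_ft embC]; first by apply; exact: ltry.
  by exists (2560 * fine (ft_norm w)).
- apply/andP; split.
    by apply: le_ereal_inf_tmp => _ [C /ft_le ftC <-].
  have [ft_fin|] := ltP (ft_norm w) +oo%E; last first.
    rewrite leye_eq => /eqP ->; rewrite gt0_muley; first exact: leey.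
    by rewrite lte_fin ltr0n.
  apply: ereal_inf_lbound; exists (2560 * fine (ft_norm w)).
    exact: emb_ft ft_fin.
  by rewrite EFinM fineK; [reflexivity|rewrite ge0_fin_numE].
Qed.

End Model.

(** * Completed measures *)

Section Completion.
Context d (T : measurableType d) (R : realType).
Variable m : {measure set T -> \bar R}.
Local Open Scope ereal_scope.

Lemma completed_measurable (A : set T) : measurable A ->
  (caratheodory_measurable (mu_ext m)) A.
Proof. exact: caratheodory_measurable_mu_ext. Qed.

Lemma completed_measureE (A : set T) : measurable A ->
  completed_measure_extension (mu := m) A = m A.
Proof. exact: measurable_mu_extE. Qed.

(** The completed measure is given by the outer measure, so a finite value provides a countable
    measurable cover with finite total measure. *)
Lemma completed_outer (A : set T) : completed_measure_extension (mu := m) A < +oo ->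
  exists B, [/\ measurable B, A `<=` B & m B < +oo].
Proof.
move=> /ereal_inf_lt[_ [B [mB AB] <-]] Boo.
exists (\bigcup_k B k); split => //; first exact: bigcupT_measurable.
apply: le_lt_trans Boo; apply: measure_sigma_subadditive => //.
exact: bigcupT_measurable.
Qed.

End Completion.

(** * The bi-parameter and Zygmund settings as dyadic models *)

Section Instances.
Variables (R : realType) (d1 d2 d3 : nat).
Variables (D1 : set (cube R d1)) (D2 : set (cube R d2)) (D3 : set (cube R d3)).
Hypotheses (gridD1 : dyadic_grid D1) (gridD2 : dyadic_grid D2)
  (gridD3 : dyadic_grid D3).

(** Over the single point of R^0 there is exactly one cube for each level, so a third side of any
    prescribed level is available. *)
Lemma grid0 : dyadic_grid [set: cube R 0].
Proof.
split=> [k x|P Q _ _ _]; last by left=> x _ [].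
exists ([tuple], k); split; first by split=> // -[].
by move=> [a l] [_ <- _]; rewrite (tuple0 a).
Qed.

Lemma side_mul e1 e2 e3 (P : cube R e1) (Q : cube R e2) (I : cube R e3) :
  (side I == side P * side Q) = (I.2 == P.2 + Q.2).
Proof.
rewrite /side -expfzDr//; apply/eqP/eqP => [|->//].
by apply: ieexprIz => //; rewrite gt_eqF// ltr1n.
Qed.

Lemma ancestor_grid d (D : set (cube R d)) (Q : cube R d) (k : nat) :
  dyadic_grid D -> D Q -> D (ancestor D Q k).
Proof. by move=> gD DQ; have [] := ancestorP gD k DQ. Qed.

Definition pt2 (x : Rn R d1 * Rn R d2) : Rn R d1 * Rn R d2 * Rn R 0 :=
  (x, [tuple]).

Lemma pt2_preimage A : pt2 @^-1` A = ysection A [tuple].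
Proof. by apply/seteqP; split=> x; rewrite /ysection /= inE. Qed.

Lemma product_leb0 A : measurable A ->
  ((@borel_leb R d1 \x @borel_leb R d2) \x @borel_leb R 0)%E A =
  (@borel_leb R d1 \x @borel_leb R d2)%E (pt2 @^-1` A).
Proof.
move=> mA; have mpA : measurable (pt2 @^-1` A).
  by rewrite pt2_preimage; exact: measurable_ysection.
have <- : (\int[@borel_leb R d1 \x @borel_leb R d2]_z (\1_(pt2 @^-1` A) z)%:E =
    (@borel_leb R d1 \x @borel_leb R d2) (pt2 @^-1` A))%E.
  by rewrite integral_indic// setIT.
apply: eq_integral => z _; rewrite /= diracE indicE; congr (nat_of_bool _)%:R%:E.
by apply/idP/idP; rewrite !inE /xsection /= ?inE.
Qed.

(** Giving the point of R^0 the sum of the other two levels makes the Zygmund relation hold by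
    construction, without affecting sets or measures. *)
Lemma biparameter_model : @dyadic_model R d1 d2 0 D1 D2 setT
  (biparameter D1 D2) pt2 (fun I => I.1) (fun I => I.2)
  (fun I => ([tuple], I.1.2 + I.2.2)).
Proof.
split.
- move=> [z y]; exists z; by rewrite /pt2 (tuple0 y).
- move=> I; apply/seteqP; split=> x /=; first by move=> [x1 x2]; split=> // -[].
  by move=> [].
- move=> A mA; apply: completed_measurable; rewrite pt2_preimage.
  exact: measurable_ysection.
- move=> A mA; rewrite product_leb0//; apply: completed_measureE.
  by rewrite pt2_preimage; exact: measurable_ysection.
- move=> Omega /completed_outer[A [mA OA Aoo]].
  exists (A `*` setT); split; first exact: measurableX.
    by move=> x /OA.
  rewrite product_leb0; last exact: measurableX.
  rewrite (_ : pt2 @^-1` _ = A)//.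
  by apply/seteqP; split=> x // [].
- by move=> [I1 I2] [J1 J2] /= -> ->.
- by [].
- by [].
- by move=> I [? ?].
- move=> Q1 Q2 [a k] DQ1 DQ2 _ /= ->; exists (Q1, Q2); split=> //=.
  by rewrite (tuple0 a).
- by move=> I k [I1 I2]; split=> //; exact: ancestor_grid.
- by move=> I k [I1 I2]; split=> //; exact: ancestor_grid.
- by move=> I k; apply/seteqP; split=> -[[x1 x2] x3] [] [? ?] ?; split=> // -[].
- by move=> I k; apply/seteqP; split=> -[[x1 x2] x3] [] [? ?] ?; split=> // -[].
Qed.

Lemma zygmund_model : @dyadic_model R d1 d2 d3 D1 D2 D3
  (zygmund D1 D2 D3) id (fun I => I.1.1) (fun I => I.1.2) (fun I => I.2).
Proof.
split.
- by move=> z; exists z.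
- by [].
- by move=> A mA; exact: completed_measurable.
- by move=> A mA; exact: completed_measureE.
- by move=> Omega /completed_outer.
- by move=> [[I1 I2] I3] [[J1 J2] J3] /= -> -> ->.
- by move=> I [_ _ _ /eqP]; rewrite side_mul => /eqP.
- by move=> I [I1 I2 I3 I4]; split=> //; rewrite I4.
- by move=> I [? ? ? _].
- move=> Q1 Q2 Q3 DQ1 DQ2 DQ3 /eqP; rewrite -side_mul => /eqP Q3E.
  by exists (Q1, Q2, Q3).
(* Extending the first side breaks the equality of side lengths but keeps the inequality that
   defines the boxes of the maximal function. *)
- move=> I k [I1 I2 I3 I4]; split=> //=; first exact: ancestor_grid.
  rewrite I4 ler_wpM2r ?side_ge0// side_le.
  by have [_ _ ->] := ancestorP gridD1 k I1; rewrite lerDr.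
- move=> I k [I1 I2 I3 I4]; split=> //=; first exact: ancestor_grid.
  rewrite I4 ler_wpM2l ?side_ge0// side_le.
  by have [_ _ ->] := ancestorP gridD2 k I2; rewrite lerDr.
- by [].
- by [].
Qed.

End Instances.

Theorem theorem1p1 (R : realType) (d1 d2 d3 : nat)
  (d1_gt0 : (0 < d1)%N) (d2_gt0 : (0 < d2)%N) (d3_gt0 : (0 < d3)%N)
  (D1 : set (cube R d1)) (D2 : set (cube R d2)) (D3 : set (cube R d3))
  (gridD1 : dyadic_grid D1) (gridD2 : dyadic_grid D2) (gridD3 : dyadic_grid D3)
  (w : nat -> nat -> R) (w12 : W12 w) (S : setting R)
  (S_setting : S = biparameter D1 D2 \/ S = zygmund D1 D2 D3) :
  [/\ (forall (Omega : set (ambient S)) (U : set (box S)), admissible Omega U ->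
        (\int[leb S]_(x in Omega) H_fun w Omega U x =
         \esum_(I in U) ((W_weight w I Omega)%:E * leb S (box_set I)))%E),
      (exists C : R, embedding_constant S w C) <-> (ft_norm w < +oo)%E,
      (ft_norm w <= optimal_constant S w <= 2560%:E * ft_norm w)%E
    & (ft_norm w < +oo)%E ->
      forall (Omega : set (ambient S)) (U : set (box S)), admissible Omega U ->
      exists G0 : set (box S),
        [/\ G0 `<=` U, sparse 8^-1 G0
          & (\int[leb S]_(x in Omega) H_fun w Omega U x <=
             2560%:E * ft_norm w * leb S (shadow G0))%E]].
Proof.
case: S_setting => ->.
  exact (model_bounds gridD1 gridD2 (grid0 R) d1_gt0 d2_gt0
    (biparameter_model gridD1 gridD2) w12).
exact (model_bounds gridD1 gridD2 gridD3 d1_gt0 d2_gt0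
  (zygmund_model D3 gridD1 gridD2) w12).
Qed.
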